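(* Let $\mathcal A_{ML}$ be the MLMC estimator based on $\{X_\ell\}$ satisfying Assumption A with $\beta>\gamma$, and suppose $V_0>0$. Then the normalized MLMC estimator satisfies the extended CLT condition; in particular $\frac{\mathcal A_{ML}(\epsilon)-\mathbb E[X_{L(\epsilon)}]}{\sqrt{\mathrm{Var}(\mathcal A_{ML}(\epsilon))}}\xrightarrow{d}\mathcal N(0,1)$ as $\epsilon\downarrow0$.
   Context: Let $(\Omega,\mathcal F,\mathbb P)$ be a probability space, $X\in L^2(\Omega)$ a real random variable and $\{X_\ell\}_{\ell=-1}^\infty\subset L^2(\Omega)$ with $X_{-1}:=0$. Put $\Delta_\ell X:=X_\ell-X_{\ell-1}$, $V_\ell:=\mathrm{Var}(\Delta_\ell X)$, and let $C_\ell>0$ denote the (given) cost of sampling $\Delta_\ell X$. Assumption A: there are positive constants $\alpha,\beta,\gamma$ with $\min(\beta,\gamma)\le 2\alpha$, and $c_\alpha>0$, such that for all $\ell\in\mathbb N_0$: $|\mathbb E[X-X_\ell]|\le c_\alpha e^{-\alpha\ell}$; $V_\ell\le C e^{-\beta\ell}$ for some constant $C>0$; and $c e^{\gamma\ell}<C_\ell<C' e^{\gamma\ell}$ for constants $0<c<C'$. Define $S_k:=\sum_{\ell=0}^k\sqrt{V_\ell C_\ell}$. MLMC estimator: for $\epsilon>0$, $L(\epsilon):=\max(\lceil \log(c_\alpha\epsilon^{-1})/\alpha\rceil,1)$, $M_\ell(\epsilon):=\max\big(\lceil \epsilon^{-2}\sqrt{V_\ell/C_\ell}\,S_{L(\epsilon)}\rceil,1\big)$,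 and $\mathcal A_{ML}(\epsilon):=\sum_{\ell=0}^{L(\epsilon)}\frac{1}{M_\ell(\epsilon)}\sum_{i=1}^{M_\ell(\epsilon)}\Delta_\ell X^i$, where the family $\{\Delta_\ell X^i\}$ is mutually independent and each $\Delta_\ell X^i$ has the law of $\Delta_\ell X$. Conventions: $0\cdot(\pm\infty)=0$, $0/0=0$. Extended CLT condition: $\frac{\mathcal A_{ML}(\epsilon)-\mathbb E[X_{L(\epsilon)}]}{\sqrt{\mathrm{Var}(\mathcal A_{ML}(\epsilon))}}\xrightarrow{d}\mathcal N(0,1)$ as $\epsilon\downarrow0$, and $\lim_{\epsilon\downarrow0}\max_{0\le\ell\le L(\epsilon)}\frac{V_\ell}{M_\ell(\epsilon)^2\,\mathrm{Var}(\mathcal A_{ML}(\epsilon))}=0$. *)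

(* Defs.v *)
From HB Require Import structures.
From mathcomp Require Import all_boot all_order all_algebra.
From mathcomp Require Import all_classical all_reals all_analysis.
Set Implicit Arguments. Unset Strict Implicit. Unset Printing Implicit Defensive.
Import Order.TTheory GRing.Theory Num.Theory.
Import numFieldNormedType.Exports.
Local Open Scope classical_set_scope.
Local Open Scope ring_scope.

Definition nat_of_intp (z : int) : nat :=
  match z with Posz n => n | Negz _ => 0%N end.

Definition ceil_max1 {R : realType} (x : R) : nat :=
  maxn (nat_of_intp (Num.ceil x)) 1.

Section mlmc.
Context {d : measure_display} {T : measurableType d} {R : realType}
  (P : probability T R).

Definition DeltaX (Xs : nat -> T -> R) (l : nat) : T -> R :=
  if l is l'.+1 then (Xs l'.+1 \- Xs l')%R else Xs 0%N.

(* V_l := Var(Delta_l X) (finite since Delta_l X is in L^2) *)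
Definition Vl (Xs : nat -> T -> R) (l : nat) : R := fine 'V_P[DeltaX Xs l].

Definition Sk (Xs : nat -> T -> R) (Cst : nat -> R) (k : nat) : R :=
  \sum_(l < k.+1) Num.sqrt (Vl Xs l * Cst l).

Definition Leps (alpha calpha eps : R) : nat :=
  ceil_max1 (ln (calpha / eps) / alpha).

Definition Mleps (Xs : nat -> T -> R) (Cst : nat -> R) (alpha calpha eps : R)
  (l : nat) : nat :=
  ceil_max1 (eps ^- 2 * Num.sqrt (Vl Xs l / Cst l) *
             Sk Xs Cst (Leps alpha calpha eps)).

(* A_ML(eps) := sum_{l=0}^{L(eps)} 1/M_l sum_{i=1}^{M_l} Delta_l X^i ;
   the samples are Y l i, i = 0, ..., M_l - 1 *)
Definition AML (Xs : nat -> T -> R) (Cst : nat -> R) (alpha calpha : R)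
  (Y : nat -> nat -> T -> R) (eps : R) : T -> R :=
  fun w => \sum_(l < (Leps alpha calpha eps).+1)
     ((Mleps Xs Cst alpha calpha eps l)%:R)^-1 *
     \sum_(i < Mleps Xs Cst alpha calpha eps l) Y l i w.

Definition mutually_independent {I : eqType} (Y : I -> {RV P >-> R}) : Prop :=
  forall (J : seq I) (B : I -> set R),
    uniq J -> (forall j, measurable (B j)) ->
    P (\big[setI/setT]_(j <- J) (Y j @^-1` B j)) =
    \big[*%E/1%E]_(j <- J) P (Y j @^-1` B j).

Definition same_law (Z W : T -> R) : Prop :=
  forall A : set R, measurable A -> P (Z @^-1` A) = P (W @^-1` A).

(* convergence in distribution, along a filter F, of the family Z to the law nu:
   convergence of the CDFs at every continuity point of the limiting CDF *)
Definition cvg_in_distribution {U : Type} (F : set_system U)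
  (Z : U -> T -> R) (nu : set R -> \bar R) : Prop :=
  forall t : R, nu [set t] = 0%E ->
    (P [set w | Z u w <= t]) @[u --> F] --> nu [set x | x <= t].

End mlmc.

(* Main.v *)
Require Import Defs.
From HB Require Import structures.
From mathcomp Require Import all_boot all_order all_algebra.
From mathcomp Require Import all_classical all_reals all_analysis.
From mathcomp Require Import measurable_realfun ring lra.
Import Order.TTheory GRing.Theory Num.Theory.
Import numFieldNormedType.Exports.
Local Open Scope classical_set_scope.
Local Open Scope ring_scope.

(* Independence of the samples gives Var A = sum_l V_l / M_l, which lies between
   two multiples of eps^2 because sqrt(V_l C_l) is dominated by a geometric
   sequence when beta > gamma.  Hence the share of level l in the normalized
   variance is O(sqrt(V_l C_l)) uniformly in eps, while on a fixed level with
   V_l > 0 the number of samples tends to infinity; dominated convergence of the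
   sum over the levels yields both the maximum condition and Lindeberg's
   condition.  Lindeberg's central limit theorem is obtained by Stein's method:
   the equation f'(x) - x f(x) = h(x) - E h(N) is solved for a piecewise linear
   approximation h of the indicator of a half-line, with f, f' bounded and f'
   Lipschitz by bounds on the Mills ratio. *)

Set Implicit Arguments. Unset Strict Implicit. Unset Printing Implicit Defensive.

(** * Real-valued expectation of integrable functions *)

Section expectation.
Context {d : measure_display} {T : measurableType d} {R : realType}
  (P : probability T R).
Implicit Types U V : T -> R.

(** The number of levels and all sample sizes move with [eps], and on high levels [M_l] may be 1
    however small [eps] is, so growth of the sample sizes cannot be uniform over the levels; what is
    uniform is the bound on the share of a level in the variance. Level 0 enters this bound twice:
    S_L >= sqrt(V_0 C_0) > 0 bounds V_l / M_l by a multiple of eps^2 sqrt(V_l C_l), and V_0 / M_0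
    alone bounds the variance from below. A level with V_l = 0 keeps a single sample for ever, but
    contributes nothing.

    Stein's method asks of independence only that each summand be independent of the sum of the
    others. When f is expanded around that sum, the remainder is quadratic in a small jump and
    linear in a large one, and the large jumps make up the Lindeberg sum. The quadratic bound needs
    a Lipschitz f', whereas for the indicator of a half-line f' itself jumps; hence the ramps, which
    enclose the indicator from both sides. *)

Definition intg U := P.-integrable setT (EFin \o U).

Definition Ex U : R := fine 'E_P[U].

Lemma ExE U : Ex U = \int[P]_x U x.
Proof. by rewrite /Ex unlock. Qed.

Lemma intg_measurable U : intg U -> measurable_fun setT U.
Proof. by case/integrableP => /measurable_EFinP. Qed.

Lemma intg_le U V : measurable_fun setT U -> intg V ->
  (forall w, `|U w| <= V w) -> intg U.
Proof.
move=> mU iV UV; apply: le_integrable iV => //; first exact/measurable_EFinP.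
by move=> x _ /=; rewrite lee_fin (le_trans (UV x)) ?ler_norm.
Qed.

Lemma intg_cst k : intg (cst k).
Proof.
by apply: finite_measure_integrable_cst.
Qed.

Lemma intg_bounded U B : measurable_fun setT U ->
  (forall w, `|U w| <= B) -> intg U.
Proof. by move=> mU UB; apply: (@intg_le U (cst B)) => //; exact: intg_cst. Qed.

Lemma intgD U V : intg U -> intg V -> intg (fun w => U w + V w).
Proof. by move=> iU iV; have := integrableD measurableT iU iV. Qed.

Lemma intgZ k U : intg U -> intg (fun w => k * U w).
Proof. by move=> iU; have := integrableZl measurableT k iU. Qed.

Lemma intgN U : intg U -> intg (fun w => - U w).
Proof. by move=> iU; have := integrableN iU. Qed.

Lemma intgB U V : intg U -> intg V -> intg (fun w => U w - V w).
Proof. by move=> iU iV; exact: intgD iU (intgN iV). Qed.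

Lemma intg_sum (I : Type) (s : seq I) (p : pred I) (U : I -> T -> R) :
  (forall i, intg (U i)) -> intg (fun w => \sum_(i <- s | p i) U i w).
Proof.
move=> iU; elim: s => [|i s IH].
  have -> : (fun w => \sum_(i <- [::] | p i) U i w) = cst 0.
    by apply/funext => w; rewrite big_nil.
  exact: intg_cst.
have [pi|pi] := boolP (p i).
- have -> : (fun w => \sum_(j <- i :: s | p j) U j w) =
      (fun w => U i w + \sum_(j <- s | p j) U j w).
    by apply/funext => w; rewrite big_cons pi.
  exact: intgD.
- have -> : (fun w => \sum_(j <- i :: s | p j) U j w) =
      (fun w => \sum_(j <- s | p j) U j w).
    by apply/funext => w; rewrite big_cons (negbTE pi).
  exact: IH.
Qed.

Lemma intg_norm U : intg U -> intg (fun w => `|U w|).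
Proof. by move=> iU; have := integrable_norm iU. Qed.

Lemma Ex_cst k : Ex (cst k) = k.
Proof. by rewrite /Ex expectation_cst. Qed.

Lemma ExD U V : intg U -> intg V -> Ex (fun w => U w + V w) = Ex U + Ex V.
Proof. by move=> iU iV; rewrite !ExE RintegralD. Qed.

Lemma ExZ k U : intg U -> Ex (fun w => k * U w) = k * Ex U.
Proof. by move=> iU; rewrite !ExE RintegralZl. Qed.

Lemma ExB U V : intg U -> intg V -> Ex (fun w => U w - V w) = Ex U - Ex V.
Proof. by move=> iU iV; rewrite !ExE RintegralB. Qed.

Lemma Ex_sum (I : Type) (s : seq I) (p : pred I) (U : I -> T -> R) :
  (forall i, intg (U i)) ->
  Ex (fun w => \sum_(i <- s | p i) U i w) = \sum_(i <- s | p i) Ex (U i).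
Proof.
move=> iU; elim: s => [|i s IH].
  rewrite big_nil -[RHS](Ex_cst 0); congr Ex.
  by apply/funext => w; rewrite big_nil.
rewrite big_cons; have [pi|pi] := boolP (p i).
- rewrite -IH -ExD//; last exact: intg_sum.
  by congr Ex; apply/funext => w; rewrite big_cons pi.
- by rewrite -IH; congr Ex; apply/funext => w; rewrite big_cons (negbTE pi).
Qed.

Lemma Ex_le U V : intg U -> intg V -> (forall w, U w <= V w) -> Ex U <= Ex V.
Proof. by move=> iU iV UV; rewrite !ExE le_Rintegral. Qed.

Lemma Ex_ge0 U : (forall w, 0 <= U w) -> 0 <= Ex U.
Proof. by move=> U0; rewrite ExE Rintegral_ge0. Qed.

Lemma Ex_norm_le U V : intg U -> intg V -> (forall w, `|U w| <= V w) ->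
  `|Ex U| <= Ex V.
Proof.
move=> iU iV UV; rewrite ExE (le_trans (le_normr_Rintegral _ _))//.
by rewrite -ExE; apply: Ex_le => //; exact: intg_norm.
Qed.

End expectation.

(** * Independence of two variables: products, and one variable against a sum of others *)

Section independence.
Context {d : measure_display} {T : measurableType d} {R : realType}
  (P : probability T R).

Definition indep2 (U V : T -> R) := forall A B, measurable A -> measurable B ->
  P (U @^-1` A `&` V @^-1` B) = (P (U @^-1` A) * P (V @^-1` B))%E.

Lemma indep2_comp (U V : T -> R) (f g : R -> R) :
  measurable_fun setT f -> measurable_fun setT g ->
  indep2 U V -> indep2 (f \o U) (g \o V).
Proof.
move=> mf mg UV A B mA mB.
by apply: (UV (f @^-1` A) (g @^-1` B)); rewrite -[X in measurable X]setTI;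
  [exact: mf|exact: mg].
Qed.

(** Independence says that the joint law agrees with the product of the two laws on rectangles,
    hence everywhere; Tonelli then gives integrability of the product and Fubini its value. *)
Lemma indep2_mul (U V : T -> R) : indep2 U V -> intg P U -> intg P V ->
  intg P (fun w => U w * V w) /\ Ex P (fun w => U w * V w) = Ex P U * Ex P V.
Proof.
move=> UV iU iV.
have mU := intg_measurable iU; have mV := intg_measurable iV.
pose U' : {RV P >-> R} := mfun_Sub (mem_set mU).
pose V' : {RV P >-> R} := mfun_Sub (mem_set mV).
have mW : measurable_fun setT (fun w => (U w, V w)) by exact: measurable_fun_pair.
pose W' : {RV P >-> (R * R)%type} := mfun_Sub (mem_set mW).
have law : forall X, measurable X ->
    (distribution P U' \x distribution P V')%E X = distribution P W' X.
  apply: product_measure_unique => A B mA mB /=.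
  by rewrite -UV//.
have mM : measurable_fun setT (fun z : R * R => (z.1 * z.2)%:E).
  by apply/measurable_EFinP; exact: measurable_funM.
have mN : measurable_fun setT (fun x : R => `|x|%:E).
  by apply: measurableT_comp => //; exact: normr_measurable.
have iprod : (distribution P U' \x distribution P V')%E.-integrable setT
    (fun z : R * R => (z.1 * z.2)%:E).
  apply/integrable12ltyP => //=.
  rewrite (eq_integral (fun x : R => `|x|%:E * \int[distribution P V']_y `|y|%:E)%E);
    last first.
    move=> x _; rewrite -ge0_integralZl//.
    by apply: eq_integral => y _; rewrite normrM EFinM.
  rewrite ge0_integralZr//; last exact: integral_ge0.
  rewrite (ge0_integral_distribution U' (f := fun x => `|x|%:E))//.
  rewrite (ge0_integral_distribution V' (f := fun x => `|x|%:E))//.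
  case/integrableP : iU => _ iU; case/integrableP : iV => _ iV.
  have I0 : (0 <= \int[P]_x ((fun x0 : R => `|x0|%:E) \o U') x)%E.
    by apply: integral_ge0 => x _ /=; rewrite lee_fin.
  by rewrite lte_mul_pinfty// ge0_fin_numE.
have iW : intg P (fun w => U w * V w).
  apply/integrableP; split; first by apply/measurable_EFinP; exact: measurable_funM.
  case/integrableP : iprod => _.
  rewrite (eq_measure_integral (distribution P W')); last first.
    by move=> A mA _; exact: law.
  rewrite (ge0_integral_distribution W' (f := fun z : R * R => `|(z.1 * z.2)%:E|%E))//.
  exact: measurableT_comp.
split => //; rewrite /Ex -fineM; last 2 first.
  - by apply: expectation_fin_num; exact/Lfun1_integrable.
  - by apply: expectation_fin_num; exact/Lfun1_integrable.
congr fine; rewrite unlock.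
transitivity (\int[(distribution P U' \x distribution P V')%E]_z (z.1 * z.2)%:E)%E.
  rewrite (eq_measure_integral (distribution P W')); last first.
    by move=> A mA _; exact: law.
  by rewrite (integral_distribution (X := W') mM).
rewrite -integral12_prod_meas1// /fubini_F /=.
have eV : (\int[distribution P V']_y y%:E = \int[P]_w (V w)%:E)%E.
  by rewrite (integral_distribution (X := V') (f := EFin)).
have eU : (\int[distribution P U']_y y%:E = \int[P]_w (U w)%:E)%E.
  by rewrite (integral_distribution (X := U') (f := EFin)).
have iV' : (distribution P V').-integrable setT (EFin : R -> \bar R).
  exact: (integrable_pushforward (phi := V')).
have iU' : (distribution P U').-integrable setT (EFin : R -> \bar R).
  exact: (integrable_pushforward (phi := U')).
rewrite (eq_integral (fun x : R => x%:E * \int[P]_w (V w)%:E)%E); last first.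
  by move=> x _; rewrite -eV -integralZl//; apply: eq_integral.
rewrite -(fineK (x := (\int[P]_w (V w)%:E)%E)); last first.
  exact: integrable_fin_num.
by rewrite integralZr// eU.
Qed.

Lemma bigsetI_seqP {I : eqType} (J : seq I) (F : I -> set T) (x : T) :
  (\big[setI/setT]_(i <- J) F i) x <-> (forall i, i \in J -> F i x).
Proof.
elim: J => [|i J IH]; first by rewrite big_nil; split.
rewrite big_cons; split => [[Fi /IH FJ] k|FJ].
  by rewrite inE => /orP[/eqP ->//|/FJ].
split; first by apply: FJ; rewrite mem_head.
by apply/IH => k kJ; apply: FJ; rewrite inE kJ orbT.
Qed.

(** A pi-lambda argument. The finite intersections of preimages under the [Y k], [k] in [J], form
    the pi-system [G]; the events independent of the fixed event [E] form the lambda-system [H]. So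
    [H] contains the sigma-algebra generated by [G], for which the sum is measurable. *)
Lemma indep2_sum {I : eqType} (Y : I -> {RV P >-> R}) (g : I -> R -> R)
    (j : I) (J : seq I) :
  mutually_independent (P := P) Y -> (forall k, measurable_fun setT (g k)) ->
  uniq (j :: J) ->
  indep2 (Y j) (fun w => \sum_(k <- J) g k (Y k w)).
Proof.
move=> indY mg uJ A B mA mB.
pose G : set (set T) := [set C | exists2 D : I -> set R,
  (forall k, measurable (D k)) & C = \big[setI/setT]_(k <- J) Y k @^-1` D k].
have GI : setI_closed G.
  move=> _ _ [D mD ->] [D' mD' ->]; exists (fun k => D k `&` D' k).
    by move=> k; exact: measurableI.
  by rewrite -big_split; apply: eq_bigr.
have mG : forall C, G C -> measurable C.
  move=> _ [D mD ->]; apply: bigsetI_measurable => k _.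
  exact: measurable_funPTI.
pose E := Y j @^-1` A.
have mE : measurable E := measurable_funPTI (Y j) mA.
pose H : set (set T) :=
  [set C | measurable C /\ P (E `&` C) = (P E * P C)%E].
have fP C : measurable C -> P C \is a fin_num by move=> mC; exact: fin_num_measure.
have lH : lambda_system setT H.
  split => //.
  - by split=> //; rewrite setIT probability_setT mule1.
  - move=> C D DC [mC PC] [mD PD]; split; first exact: measurableD.
    have -> : E `&` (C `\` D) = (E `&` C) `\` (E `&` D).
      by rewrite setIDA; apply/seteqP; split => x /=; tauto.
    rewrite !measureD//=; try exact: measurableI.
    + rewrite -setIIr (setIidr DC) PC PD muleBr ?fP//.
      by rewrite fin_num_adde_defr// fP.
    + by rewrite ltey_eq fP.
    + by rewrite ltey_eq fP//; exact: measurableI.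
  - move=> F ndF FH; have mF k : measurable (F k) by case: (FH k).
    have mU : measurable (\bigcup_k F k) by exact: bigcupT_measurable.
    split => //.
    have c1 : (P \o F) n @[n --> \oo] --> P (\bigcup_k F k).
      exact: nondecreasing_cvg_mu.
    have c2 : (P \o (fun k => E `&` F k)) n @[n --> \oo] --> P (E `&` \bigcup_k F k).
      rewrite setI_bigcupr; apply: nondecreasing_cvg_mu => //.
      + by move=> k; exact: measurableI.
      + by apply: bigcupT_measurable => k; exact: measurableI.
      + by move=> m n mn; apply/subsetPset; apply: setIS; exact/subsetPset/ndF.
    have c3 : (P \o (fun k => E `&` F k)) n @[n --> \oo] --> (P E * P (\bigcup_k F k))%E.
      have -> : (P \o (fun k => E `&` F k)) = (fun k => P E * (P \o F) k)%E.
        by apply/funext => k /=; case: (FH k).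
      by apply: cvgeZl => //; exact: fP.
    exact: (cvg_unique _ c2 c3).
have GH : G `<=` H.
  move=> _ [D mD ->]; split; first by apply: mG; exists D.
  have [jJ uJ'] := andP uJ.
  (* One family of sets on [j :: J] that encodes both events; since [j] is not in [J], the
     modification at [j] leaves the intersection over [J] unchanged. *)
  pose D' k := if k == j then A else D k.
  have mD' k : measurable (D' k) by rewrite /D'; case: ifP.
  have eqD k : k \in J -> D' k = D k.
    by move=> kJ; rewrite /D'; case: eqP => // kj; rewrite -kj kJ in jJ.
  have := indY (j :: J) D' uJ mD'.
  rewrite !big_cons {1 2}/D' eqxx -/E.
  have -> : \big[setI/setT]_(k <- J) (Y k @^-1` D' k) =
            \big[setI/setT]_(k <- J) (Y k @^-1` D k).
    by apply: eq_big_seq => k /eqD ->.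
  move=> ->; congr (_ * _)%E; first by rewrite /D' eqxx.
  rewrite (indY J D uJ' mD).
  by apply: eq_big_seq => k /eqD ->.
have SH : <<s G >> `<=` H by apply: lambda_system_subset.
apply: (SH _ _).2.
have mY k : k \in J -> measurable_fun setT (Y k : g_sigma_algebraType G -> R).
  move=> kJ _ C mC; rewrite setTI; apply: sub_sigma_algebra.
  exists (fun i => if i == k then C else setT).
    by move=> i; case: ifP.
  apply/seteqP; split => x.
    by move=> Cx; apply/bigsetI_seqP => i iJ; rewrite /preimage/=; case: eqP => // ->.
  by move=> /bigsetI_seqP/(_ k kJ); rewrite /preimage/= eqxx.
have mV : measurable_fun setT
    ((fun w => \sum_(k <- J) g k (Y k w)) : g_sigma_algebraType G -> R).
  (* Only the [Y k] with [k] in [J] are known to be measurable for the generated sigma-algebra,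
     while [measurable_sum] asks it of every index; the other terms are replaced by 0. *)
  have -> : (fun w => \sum_(k <- J) g k (Y k w)) =
     (fun w => \sum_(k <- J) (if k \in J then g k (Y k w) else 0)).
    by apply/funext => w; apply: eq_big_seq => k ->.
  apply: (@measurable_sum _ (g_sigma_algebraType G) R setT I J
    (fun k w => if k \in J then g k (Y k w) else 0)) => k.
  have [kJ|_] := boolP (k \in J); last exact: measurable_cst.
  by apply: measurableT_comp => //; exact: mY.
by have := mV measurableT B mB; rewrite setTI.
Qed.

End independence.

(** * One-variable calculus: mean values, Lipschitz bounds, primitives from minus infinity *)

Section calculus.
Context {R : realType}.
Implicit Types (f df : R -> R) (a b x y : R).

Lemma is_derive_continuous f df : (forall x, is_derive x 1 f (df x)) ->
  continuous f.
Proof.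
by move=> fd x; apply: differentiable_continuous; apply/derivable1_diffP; case: (fd x).
Qed.

Lemma MVT_setT f df x y : (forall x, is_derive x 1 f (df x)) ->
  exists c, f y - f x = df c * (y - x).
Proof.
move=> fd; have cf := is_derive_continuous fd.
wlog xy : x y / x <= y.
  move=> H; have [/H//|/ltW/H[c fc]] := leP x y.
  by exists c; rewrite -(opprB (f x)) fc; ring.
have [|c _ fc] := @MVT_segment _ f df x y xy (fun z _ => fd z); last by exists c.
exact/continuous_subspaceT.
Qed.

Lemma derive_bounded_lipschitz f df K : (forall x, is_derive x 1 f (df x)) ->
  (forall x, `|df x| <= K) -> forall x y, `|f x - f y| <= K * `|x - y|.
Proof.
move=> fd fK x y; have [c ->] := MVT_setT y x fd.
by rewrite normrM ler_wpM2r.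
Qed.

Lemma lipschitz_continuous f K :
  (forall x y, `|f x - f y| <= K * `|x - y|) -> continuous f.
Proof.
move=> fK x; apply/cvgrPdist_lt => e e0.
have K1 : 0 < `|K| + 1 by rewrite ltr_wpDl.
near=> t; rewrite (le_lt_trans (fK _ _))//.
rewrite (@le_lt_trans _ _ ((`|K| + 1) * `|x - t|))//.
  by rewrite ler_wpM2r// (le_trans (ler_norm _))// lerDl.
rewrite mulrC -ltr_pdivlMr//; near: t.
by apply: (@cvgr_dist_lt _ _ _ _ _ id x); [exact: cvg_id|exact: divr_gt0].
Unshelve. all: by end_near. Qed.

Lemma derivable_is_derive f x y : derivable f x 1 -> derive1 f x = y ->
  is_derive x 1 f y.
Proof. by move=> fx <-; rewrite derive1E; exact: DeriveDef. Qed.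

Lemma is_derive_integralNy f x :
  (forall y, (@lebesgue_measure R).-integrable `]-oo, y] (EFin \o f)) ->
  continuous f ->
  is_derive x 1 (fun y => \int[@lebesgue_measure R]_(t in `]-oo, y]) f t) (f x).
Proof.
move=> fi cf; have xx1 : x < x + 1 by rewrite ltrDl.
have [df ef] := @continuous_FTC1 R f -oo%O x (x + 1) xx1 (fi _) (ltNyr _) (cf x).
exact: derivable_is_derive df ef.
Qed.

(** Reduces an inequality between two functions that vanish at infinity to the sign of a derivative;
    both Mills bounds are proved this way. *)
Lemma ge0_of_nonincreasing_to0 f df a :
  (forall x, a <= x -> is_derive x 1 f (df x)) ->
  (forall x, a <= x -> df x <= 0) -> f x @[x --> +oo] --> 0 -> 0 <= f a.
Proof.
move=> fd df0 f0; apply: (cvgr_to_le f0); near=> y.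
have ay : a <= y by near: y; apply: nbhs_pinfty_ge; exact: num_real.
have dz z : z \in `]a, y[%R -> is_derive z 1 f (df z).
  by rewrite in_itv/= => /andP[az _]; apply: fd; exact: ltW.
have cf : {within `[a, y], continuous f}.
  apply: derivable_within_continuous => z; rewrite in_itv/= => /andP[az _].
  by case: (fd z az).
have [c cay fc] := MVT_segment ay dz cf.
rewrite -subr_le0 fc mulr_le0_ge0 ?subr_ge0// df0//.
by move: cay; rewrite in_itv/= => /andP[].
Unshelve. all: by end_near. Qed.

End calculus.

(** * The normal density, its distribution function and the Mills ratio *)

Section gauss.
Context {R : realType}.
Local Notation mu := (@lebesgue_measure R).
Implicit Types (a b x y : R).

Definition gauss : R -> R := normal_pdf 0 1.
Definition Gauss x : R := \int[mu]_(t in `]-oo, x]) gauss t.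
(** The reciprocal of the density ([gaussK]); it serves as the integrating factor of Stein's
    equation. *)
Definition gaussV x : R := (normal_peak 1)^-1 * expR (x ^+ 2 / 2).

Lemma gaussE x : gauss x = normal_peak 1 * expR (- (x ^+ 2 / 2)).
Proof.
by rewrite /gauss normal_pdfE ?oner_neq0// /normal_fun subr0 expr1n mulNr.
Qed.

Lemma gauss_gt0 x : 0 < gauss x.
Proof. by rewrite gaussE mulr_gt0 ?expR_gt0// normal_peak_gt0 ?oner_neq0. Qed.

Lemma gaussV_gt0 x : 0 < gaussV x.
Proof. by rewrite mulr_gt0 ?expR_gt0// invr_gt0 normal_peak_gt0 ?oner_neq0. Qed.

Lemma gaussK x : gauss x * gaussV x = 1.
Proof.
rewrite gaussE /gaussV mulrACA divff; last first.
  by rewrite gt_eqF// normal_peak_gt0 ?oner_neq0.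
by rewrite mul1r -expRD addNr expR0.
Qed.

Lemma gaussN x : gauss (- x) = gauss x.
Proof. by rewrite !gaussE sqrrN. Qed.

Lemma is_derive_sqr_half x : is_derive x 1 (fun x : R => x ^+ 2 / 2) x.
Proof.
have -> : (fun x : R => x ^+ 2 / 2) = 2^-1 \*: (fun x : R => x ^+ 2).
  by apply/funext => y; rewrite /= mulrC.
by apply: is_derive_eq; rewrite /= /GRing.scale/=; field.
Qed.

Lemma is_derive_gauss x : is_derive x 1 gauss (- x * gauss x).
Proof.
have -> : gauss = normal_peak 1 \*: (expR \o (fun x : R => - (x ^+ 2 / 2))).
  by apply/funext => y; rewrite gaussE.
have d1 : is_derive x 1 (fun x : R => - (x ^+ 2 / 2)) (- x).
  by have := is_deriveN (is_derive_sqr_half x).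
have d2 := @is_derive1_comp _ expR (fun x => - (x ^+ 2 / 2)) x _ _
    (is_derive_expR _) d1.
by apply: is_derive_eq; rewrite /= /GRing.scale/=; ring.
Qed.

Lemma is_derive_gaussV x : is_derive x 1 gaussV (x * gaussV x).
Proof.
have d1 := is_derive_sqr_half x.
have d2 := @is_derive1_comp _ expR (fun x => x ^+ 2 / 2) x _ _
    (is_derive_expR _) d1.
have -> : gaussV = (normal_peak 1)^-1 \*: (expR \o (fun x : R => x ^+ 2 / 2)).
  by [].
by apply: is_derive_eq; rewrite /= /GRing.scale/=; ring.
Qed.

Lemma continuous_gauss : continuous gauss.
Proof. by apply: continuous_normal_pdf; exact: oner_neq0. Qed.

Lemma integrable_gauss (D : set R) : measurable D ->
  mu.-integrable D (EFin \o gauss).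
Proof.
move=> mD; apply: (integrableS measurableT) => //.
exact: integrable_normal_pdf.
Qed.

Lemma is_derive_Gauss x : is_derive x 1 Gauss (gauss x).
Proof.
apply: is_derive_integralNy; last exact: continuous_gauss.
by move=> y; exact: integrable_gauss.
Qed.

Lemma normal_prob_itvE x :
  normal_prob 0 1 [set y : R | y <= x] = (Gauss x)%:E.
Proof.
rewrite /normal_prob /Gauss /Rintegral fineK; last first.
  by apply: integrable_fin_num => //; exact: integrable_gauss.
by rewrite set_itvE.
Qed.

(** Under the normal law the identity is a random variable with distribution function [Gauss], so
    the general limits of a distribution function at both infinities apply. *)
Let idTR : measurableTypeR R -> R := idfun.
#[local] HB.instance Definition _ :=
  @isMeasurableFun.Build _ _ _ _ idTR (@measurable_id _ _ setT).

Let idRV : {RV (@normal_prob R 0 1) >-> R} := idTR.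

Let cdf_idE x :
  cdf idRV x = (Gauss x)%:E.
Proof. by rewrite -normal_prob_itvE /cdf set_itvE. Qed.

Lemma cvg_Gaussy : Gauss x @[x --> +oo] --> (1 : R).
Proof.
rewrite (_ : Gauss = fine \o cdf idRV).
  by apply: fine_cvg; exact: cvg_cdfy1.
by apply/funext => x; exact: (esym (congr1 fine (cdf_idE x))).
Qed.

Lemma cvg_GaussNy : Gauss x @[x --> -oo] --> (0 : R).
Proof.
rewrite (_ : Gauss = fine \o cdf idRV).
  by apply: fine_cvg; exact: cvg_cdfNy0.
by apply/funext => x; exact: (esym (congr1 fine (cdf_idE x))).
Qed.

(** Stated for any [q] with derivative [- gauss] and limit 0, so as to cover both the upper tail
    [1 - Gauss x] and the reflected lower tail [Gauss (- x)]. Each bound compares [q] with a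
    multiple of [gauss]; the derivative of the difference has a constant sign. *)
Lemma Mills (q : R -> R) : (forall x, is_derive x 1 q (- gauss x)) ->
  q x @[x --> +oo] --> 0 -> forall x, 0 < x ->
  x / (1 + x ^+ 2) <= q x * gaussV x <= x^-1.
Proof.
move=> dq q0.
have peak0 : 0 < normal_peak 1 :> R by rewrite normal_peak_gt0 ?oner_neq0.
have gle x : gauss x <= normal_peak 1.
  by rewrite /gauss; apply: normal_pdf_ub; exact: oner_neq0.
(* Both comparison functions are a factor of size at most 1/x times the bounded density, hence
   vanish at infinity. *)
have cvg0 (r : R -> R) : (forall x, 0 < x -> `|r x| <= x^-1) ->
    r x * gauss x @[x --> +oo] --> 0.
  move=> rx; apply/cvgr0Pnorm_le => e e0; near=> t.
  have t0 : 0 < t by near: t; apply: nbhs_pinfty_gt; exact: num_real.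
  have te : e^-1 * normal_peak 1 <= t.
    by near: t; apply: nbhs_pinfty_ge; exact: num_real.
  rewrite normrM (gtr0_norm (gauss_gt0 t)) (@le_trans _ _ (t^-1 * normal_peak 1))//.
    by rewrite ler_pM ?rx// ltW ?gauss_gt0.
  rewrite mulrC ler_pdivrMr// -ler_pdivrMl//.
move=> x x0.
have gK z : z * gauss x * gaussV x = z by rewrite -mulrA gaussK mulr1.
apply/andP; split.
- rewrite -[leLHS]gK.
  apply: ler_wpM2r; first exact/ltW/gaussV_gt0.
  rewrite -subr_ge0.
  pose r y : R := y / (1 + y ^+ 2).
  have s0 y : 1 + y ^+ 2 != 0 :> R by rewrite gt_eqF// ltr_pwDl// sqr_ge0.
  have dr y : is_derive y 1 r ((1 - y ^+ 2) / (1 + y ^+ 2) ^+ 2).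
    have d1 : is_derive y 1 (fun y : R => 1 + y ^+ 2) (2 * y).
      by apply: is_derive_eq; rewrite /= /GRing.scale/=; ring.
    have d2 := is_deriveV (f := fun y : R => 1 + y ^+ 2) (s0 y) d1.
    have d3 := is_deriveM (is_derive_id y 1) d2.
    apply: (is_derive_eq d3); rewrite /= /GRing.scale/=; field.
    exact: s0.
  apply: (@ge0_of_nonincreasing_to0 _ (fun y => q y - r y * gauss y)
     (fun y => - (2 / (1 + y ^+ 2) ^+ 2 * gauss y)) x).
  + move=> y _; have d4 := is_deriveB (dq y) (is_deriveM (dr y) (is_derive_gauss y)).
    apply: (is_derive_eq d4); rewrite /= /GRing.scale/= /r; field.
    exact: s0.
  + move=> y _; rewrite oppr_le0 mulr_ge0//; last exact/ltW/gauss_gt0.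
    by rewrite divr_ge0// sqr_ge0.
  + rewrite -[X in _ --> X](subr0 0); apply: cvgB => //; apply: cvg0 => y y0.
    rewrite /r ger0_norm; last by rewrite divr_ge0// ?(ltW y0)// addr_ge0// sqr_ge0.
    rewrite ler_pdivrMr; last by rewrite ltr_pwDl// sqr_ge0.
    by rewrite ler_pdivlMl// -expr2 lerDr.
- rewrite -[leRHS]gK.
  apply: ler_wpM2r; first exact/ltW/gaussV_gt0.
  rewrite -subr_ge0.
  apply: (@ge0_of_nonincreasing_to0 _ (fun y => y^-1 * gauss y - q y)
     (fun y => - (y ^- 2 * gauss y)) x).
  + move=> y xy; have y0 : y != 0 by rewrite gt_eqF// (lt_le_trans x0).
    have d1 := is_deriveV (f := id) y0 (is_derive_id y 1).
    have d2 := is_deriveB (is_deriveM d1 (is_derive_gauss y)) (dq y).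
    apply: (is_derive_eq d2); rewrite /= /GRing.scale/=; field.
    exact: y0.
  + by move=> y _; rewrite oppr_le0 mulr_ge0// ?invr_ge0 ?sqr_ge0// ltW// gauss_gt0.
  + rewrite -[X in _ --> X](subr0 0); apply: cvgB => //; apply: cvg0 => y y0.
    by rewrite gtr0_norm ?invr_gt0.
Unshelve. all: by end_near. Qed.

Lemma Mills_right x : 0 < x ->
  x / (1 + x ^+ 2) <= (1 - Gauss x) * gaussV x <= x^-1.
Proof.
apply: (@Mills (fun x => 1 - Gauss x)) => [y|].
  have := is_deriveB (is_derive_cst (1 : R) y 1) (is_derive_Gauss y).
  by move=> d; apply: (is_derive_eq d); rewrite sub0r.
by rewrite -[X in _ --> X](subrr (1 : R)); apply: cvgB cvg_Gaussy; exact: cvg_cst.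
Qed.

Lemma Mills_left x : 0 < x ->
  x / (1 + x ^+ 2) <= Gauss (- x) * gaussV x <= x^-1.
Proof.
apply: (@Mills (fun x => Gauss (- x))) => [y|].
  have d1 : is_derive y 1 (-%R) (-1 : R) by exact: is_deriveNid.
  have := @is_derive1_comp _ Gauss (-%R) y _ _ (is_derive_Gauss _) d1.
  by move=> d; apply: (is_derive_eq d); rewrite gaussN mulrN1.
by have /cvgNy_compNP := cvg_GaussNy.
Qed.

End gauss.

(** * Stein's equation for a ramp *)

Section stein_equation.
Context {R : realType}.
Local Notation mu := (@lebesgue_measure R).
Implicit Types (x y : R).

Lemma gaussV_even x : gaussV (- x) = gaussV x.
Proof. by rewrite /gaussV sqrrN. Qed.

Lemma gaussV_le x y : `|x| <= `|y| -> gaussV x <= gaussV y.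
Proof.
move=> xy; rewrite /gaussV ler_wpM2l//.
  by rewrite invr_ge0 normal_peak_ge0.
rewrite ler_expR ler_pM2r ?invr_gt0//.
by rewrite -(real_normK (num_real x)) -(real_normK (num_real y)) lerXn2r// nnegrE.
Qed.

Lemma Gauss_ge0 x : 0 <= Gauss x.
Proof. by rewrite -lee_fin -normal_prob_itvE. Qed.

Lemma Gauss_le1 x : Gauss x <= 1.
Proof.
rewrite -lee_fin -normal_prob_itvE.
have <- : `]-oo, x]%classic = [set y : R | y <= x] by rewrite set_itvE.
exact: probability_le1.
Qed.

(** For [a < b] it lies between the indicators of []-oo, a]] and []-oo, b]], and its slope is
    bounded by [(b - a)^-1]. *)
Definition ramp (a b x : R) := Num.max 0 (Num.min 1 ((b - x) / (b - a))).

Context (a b : R) (ab : a < b).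
Local Notation h := (ramp a b).

Lemma ramp_ge0 x : 0 <= h x.
Proof. by rewrite /ramp le_max lexx. Qed.

Lemma ramp_le1 x : h x <= 1.
Proof. by rewrite /ramp ge_max ler01 ge_min lexx. Qed.

Lemma ramp_left x : x <= a -> h x = 1.
Proof.
move=> xa; rewrite /ramp min_l; last first.
  have b0 : 0 < b - a by rewrite subr_gt0.
  by rewrite ler_pdivlMr//; lra.
by rewrite max_r.
Qed.

Lemma ramp_right x : b <= x -> h x = 0.
Proof.
move=> bx; rewrite /ramp max_l// ge_min; apply/orP; right.
have b0 : 0 < b - a by rewrite subr_gt0.
by rewrite ler_pdivrMr//; lra.
Qed.

Lemma ramp_lipschitz x y : `|h x - h y| <= (b - a)^-1 * `|x - y|.
Proof.
have clamp (u v : R) :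
  `|Num.max 0 (Num.min 1 u) - Num.max 0 (Num.min 1 v)| <= `|u - v|.
  rewrite /Order.max /Order.min ler_norml; have := ler_norm (u - v).
  have := ler_norm (v - u); rewrite (distrC v u).
  do ![case: ifPn; rewrite -?leNgt]; move=> *; lra.
apply: (le_trans (clamp _ _)); rewrite -mulrBl normrM mulrC.
have b0 : 0 < (b - a)^-1 by rewrite invr_gt0 subr_gt0.
by rewrite (gtr0_norm b0) distrC ler_pM2l// (_ : b - y - (b - x) = x - y)//; ring.
Qed.

Lemma continuous_ramp : continuous h.
Proof. exact/lipschitz_continuous/ramp_lipschitz. Qed.

Definition ramp_gauss x := h x * gauss x.
Definition ramp_prim x := \int[mu]_(t in `]-oo, x]) ramp_gauss t.

Lemma continuous_ramp_gauss : continuous ramp_gauss.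
Proof.
by move=> x; apply: continuousM; [exact: continuous_ramp|exact: continuous_gauss].
Qed.

Lemma integrable_ramp_gauss (D : set R) : measurable D ->
  mu.-integrable D (EFin \o ramp_gauss).
Proof.
move=> mD; apply: (@le_integrable _ _ _ mu D mD _ (EFin \o gauss)) => //;
  last exact: integrable_gauss.
  apply/measurable_EFinP; apply: measurable_funTS.
  by apply: continuous_measurable_fun; exact: continuous_ramp_gauss.
move=> x _ /=; rewrite lee_fin /ramp_gauss normrM ger0_norm ?ramp_ge0//.
by rewrite ler_piMl ?ramp_le1.
Qed.

Lemma is_derive_ramp_prim x : is_derive x 1 ramp_prim (ramp_gauss x).
Proof.
apply: is_derive_integralNy; last exact: continuous_ramp_gauss.
by move=> y; exact: integrable_ramp_gauss.
Qed.

Lemma ramp_prim_ge0 x : 0 <= ramp_prim x.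
Proof.
by apply: Rintegral_ge0 => t _; rewrite mulr_ge0 ?ramp_ge0// ltW ?gauss_gt0.
Qed.

Lemma ramp_prim_le x : ramp_prim x <= Gauss x.
Proof.
apply: le_Rintegral => //; first exact: integrable_ramp_gauss.
  exact: integrable_gauss.
by move=> t _; rewrite ler_piMl ?ramp_le1// ltW ?gauss_gt0.
Qed.

Lemma ramp_prim_left x : x <= a -> ramp_prim x = Gauss x.
Proof.
move=> xa; apply: eq_Rintegral => t; rewrite inE/= in_itv/= => tx.
by rewrite /ramp_gauss ramp_left ?mul1r// (le_trans tx).
Qed.

Lemma ramp_prim_right x : b <= x -> ramp_prim x = ramp_prim b.
Proof.
move=> bx; apply/eqP; rewrite -subr_eq0.
have [|c] := MVT_segment bx (fun z _ => is_derive_ramp_prim z).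
  exact/continuous_subspaceT/is_derive_continuous/is_derive_ramp_prim.
rewrite in_itv/= => /andP[bc _] ->.
by rewrite /ramp_gauss ramp_right// !mul0r.
Qed.

(** The full expectation E h(N) for a standard normal N: the integral may stop at [b], beyond which
    the ramp vanishes. *)
Definition ramp_mean := ramp_prim b.

Lemma ramp_mean_ge : Gauss a <= ramp_mean.
Proof.
rewrite -ramp_prim_left// -subr_ge0.
have [c ->] := MVT_setT a b is_derive_ramp_prim.
by rewrite mulr_ge0 ?subr_ge0 ?(ltW ab)// mulr_ge0 ?ramp_ge0// ltW ?gauss_gt0.
Qed.

Lemma ramp_mean_le : ramp_mean <= Gauss b.
Proof. exact: ramp_prim_le. Qed.

Local Notation c := ramp_mean.

Lemma ramp_mean_ge0 : 0 <= c. Proof. exact: ramp_prim_ge0. Qed.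

Lemma ramp_mean_le1 : c <= 1.
Proof. exact: le_trans ramp_mean_le (Gauss_le1 b). Qed.

(** Stein's equation f' - x f = h - c is equivalent to (f gauss)' = (h - c) gauss. Integrating from
    minus infinity and dividing by the density gives this solution; [dstein] is f' as the equation
    prescribes it. *)
Definition stein x := (ramp_prim x - c * Gauss x) * gaussV x.
Definition dstein x := x * stein x + (h x - c).

Lemma is_derive_stein x : is_derive x 1 stein (dstein x).
Proof.
have d1 : is_derive x 1 (fun x => ramp_prim x - c * Gauss x) _ :=
  is_deriveB (is_derive_ramp_prim x) (is_deriveZ c (is_derive_Gauss x)).
have d2 := is_deriveM d1 (is_derive_gaussV x).
apply: (is_derive_eq d2); rewrite /= /GRing.scale/= /dstein /stein /ramp_gauss.
transitivity (x * ((ramp_prim x - c * Gauss x) * gaussV x) +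
   (h x - c) * (gauss x * gaussV x)); first by ring.
by rewrite gaussK mulr1.
Qed.

(** With [m] the Mills ratio at [y], the three quantities are, up to sign, f, x f and x f' on a tail
    where the ramp is constant. The third is the delicate one: the lower Mills bound gives y (y m -
    1) = m (1 + y^2) - y - m >= - m >= -1. *)
Lemma Mills_tail (s y m : R) : 0 <= s <= 1 -> 1 <= y ->
  y / (1 + y ^+ 2) <= m <= y^-1 ->
  [/\ `|s * m| <= 1, `|y * (s * m)| <= 1 & `|y * (y * (s * m) - s)| <= 1].
Proof.
move=> /andP[s0 s1] y1 /andP[lm mu].
have y0 : 0 < y by lra.
have d0 : 0 < 1 + y ^+ 2 by rewrite ltr_pwDl// sqr_ge0.
have m0 : 0 <= m by rewrite (le_trans _ lm)// divr_ge0// ltW.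
have ym : y * m <= 1 by rewrite mulrC -ler_pdivlMr// mul1r.
have m1 : m <= 1 by rewrite (le_trans mu)// invf_le1.
have lm' : y <= m * (1 + y ^+ 2) by rewrite -ler_pdivrMr.
have ym' : -1 <= y * (y * m - 1).
  have -> : y * (y * m - 1) = m * (1 + y ^+ 2) - y - m by ring.
  by lra.
have ym0 : 0 <= y * m by rewrite mulr_ge0// ltW.
split.
- by rewrite ger0_norm ?mulr_ge0//; nra.
- rewrite mulrCA ger0_norm; last exact: mulr_ge0.
  by rewrite mulr_ile1.
- have -> : y * (y * (s * m) - s) = s * (y * (y * m - 1)) by ring.
  have t0 : y * (y * m - 1) <= 0 by rewrite mulr_ge0_le0 ?(ltW y0)// subr_le0.
  by rewrite normrM (ger0_norm s0) (ler0_norm t0) mulr_ile1//; lra.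
Qed.

(** Beyond this radius the ramp is constant and the argument has absolute value at least 1, as
    [Mills_tail] requires. *)
Definition stein_cut := `|a| + `|b| + 1.
Local Notation K := stein_cut.

Lemma stein_tail x : K <= `|x| ->
  [/\ `|stein x| <= 1, `|x * stein x| <= 1 & `|x * dstein x| <= 1].
Proof.
move=> Kx; have c0 := ramp_mean_ge0; have c1 := ramp_mean_le1.
have a0 := normr_ge0 a; have b0 := normr_ge0 b.
have aa : - `|a| <= a by rewrite lerNl -normrN ler_norm.
have bb := ler_norm b; rewrite /stein_cut in Kx.
have [x0|x0] := leP 0 x.
- rewrite (ger0_norm x0) in Kx.
  have bx : b <= x by lra.
  have x1 : 1 <= x by lra.
  have eS : stein x = c * ((1 - Gauss x) * gaussV x).
    by rewrite /stein ramp_prim_right// -/c; ring.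
  have [|||h1 h2 h3] := @Mills_tail c x ((1 - Gauss x) * gaussV x).
  + by rewrite c0 c1.
  + exact: x1.
  + by apply: Mills_right; lra.
  by rewrite /dstein ramp_right// sub0r eS; split.
- rewrite (ltr0_norm x0) in Kx.
  have xa : x <= a by lra.
  have x1 : 1 <= - x by lra.
  have eS : stein x = (1 - c) * (Gauss (- - x) * gaussV (- x)).
    by rewrite /stein ramp_prim_left// gaussV_even opprK; ring.
  have [|||h1 h2 h3] := @Mills_tail (1 - c) (- x) (Gauss (- - x) * gaussV (- x)).
  + by apply/andP; split; lra.
  + exact: x1.
  + by apply: Mills_left; lra.
  rewrite /dstein ramp_left// eS; split => //.
    by rewrite -normrN -mulNr.
  by move: h3; congr (`|_| <= _); ring.
Qed.

Lemma stein_middle x : `|x| <= K -> `|stein x| <= gaussV K.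
Proof.
move=> xK; rewrite /stein normrM (gtr0_norm (gaussV_gt0 x)).
have c0 := ramp_mean_ge0; have c1 := ramp_mean_le1.
rewrite -[leRHS]mul1r ler_pM//; first exact/ltW/gaussV_gt0.
- have := ramp_prim_ge0 x; have := ramp_prim_le x.
  have := Gauss_ge0 x; have := Gauss_le1 x => *.
  have : 0 <= c * Gauss x <= 1 by rewrite mulr_ge0//= mulr_ile1.
  by move=> /andP[? ?]; rewrite ler_norml; lra.
- by apply: gaussV_le; rewrite (ger0_norm (_ : 0 <= K)) ?addr_ge0.
Qed.

(** The bound on [x * dstein x] is there for [stein_lipschitz]. Inside the cut everything is bounded
    by crude estimates, outside by the Mills bounds. *)
Lemma stein_bounded : exists B, forall x,
  [/\ `|stein x| <= B, `|dstein x| <= B & `|x * dstein x| <= B].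
Proof.
have K0 : 0 <= K by rewrite !addr_ge0.
have K1 : 1 <= K by rewrite lerDr addr_ge0.
set V := gaussV K; have V0 : 0 < V := gaussV_gt0 K.
have hc x : `|h x - c| <= 1.
  have := ramp_ge0 x; have := ramp_le1 x.
  have := ramp_mean_ge0; have := ramp_mean_le1.
  by rewrite ler_norml; move=> *; lra.
have KV : 0 <= K * V by rewrite mulr_ge0// ltW.
have VKV : V <= K * V by rewrite ler_peMl// ltW.
have dK x : `|x * stein x| <= K * V + 1 -> `|dstein x| <= K * V + 2.
  move=> H; rewrite (le_trans (ler_normD _ _))//; have := hc x; lra.
(* Inside the cut [|dstein x|] is at most [K * V + 2] and [|x|] at most [K]; as [K >= 1], the
   product also dominates all the other bounds. *)
exists (K * (K * V + 2)) => x.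
have KK : K * V + 2 <= K * (K * V + 2) by rewrite ler_peMl//; lra.
have [xK|/ltW xK] := leP `|x| K.
- have sV := stein_middle xK; rewrite -/V in sV.
  have xs : `|x * stein x| <= K * V by rewrite normrM ler_pM.
  have dK' : `|dstein x| <= K * V + 2 by apply: dK; lra.
  split; [lra|lra|].
  by rewrite normrM ler_pM.
- have [s1 s2 s3] := stein_tail xK.
  have dK' : `|dstein x| <= K * V + 2 by apply: dK; lra.
  by split; lra.
Qed.

(** The corners of the ramp prevent a bound through a second derivative of [stein]. Instead [dstein]
    is split into [x * stein x], whose derivative [stein x + x * dstein x] is bounded, and the ramp,
    which is Lipschitz. *)
Lemma stein_lipschitz : exists B, forall x y,
  `|dstein x - dstein y| <= B * `|x - y|.
Proof.
have [B sB] := stein_bounded.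
have dg x : is_derive x 1 (fun x => x * stein x) (stein x + x * dstein x).
  have := is_deriveM (is_derive_id x 1) (is_derive_stein x).
  by move=> d; apply: (is_derive_eq d); rewrite /= /GRing.scale/=; ring.
have bg x : `|stein x + x * dstein x| <= B + B.
  by have [s1 _ s3] := sB x; rewrite (le_trans (ler_normD _ _))// lerD.
exists (B + B + (b - a)^-1) => x y.
have -> : dstein x - dstein y = (x * stein x - y * stein y) + (h x - h y).
  by rewrite /dstein; ring.
rewrite (le_trans (ler_normD _ _))// mulrDl lerD ?ramp_lipschitz//.
exact: (derive_bounded_lipschitz dg bg).
Qed.

End stein_equation.

(** * First-order Taylor bounds and truncated squares *)

Section taylor.
Context {R : realType}.

(** The linear bound is for large increments, the quadratic one for small increments. Used alone in
    [stein_step], the quadratic bound would require third moments. *)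
Lemma taylor1_lipschitz (f df : R -> R) (B K : R) :
  (forall x : R, is_derive x 1 f (df x)) -> (forall x, `|df x| <= B) ->
  (forall x y, `|df x - df y| <= K * `|x - y|) -> 0 <= K ->
  forall u x, `|f (u + x) - f u - x * df u| <= 2 * B * `|x| /\
              `|f (u + x) - f u - x * df u| <= K * x ^+ 2.
Proof.
move=> fd fB fK K0 u x.
have [c cux fc] : exists2 c, `|c - u| <= `|x| & f (u + x) - f u = df c * x.
  have cf y z : {within `[y, z], continuous f}.
    exact/continuous_subspaceT/(is_derive_continuous fd).
  have [x0|x0] := leP 0 x.
    have ux : u <= u + x by rewrite lerDl.
    have [c cu fc] := MVT_segment ux (fun z _ => fd z) (cf _ _).
    exists c; last by rewrite fc (_ : u + x - u = x)//; ring.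
    by move: cu; rewrite in_itv/= => /andP[? ?]; rewrite !ger0_norm//; lra.
  have ux : u + x <= u by lra.
  have [c cu fc] := MVT_segment ux (fun z _ => fd z) (cf _ _).
  exists c; last by rewrite -opprB fc; ring.
  by move: cu; rewrite in_itv/= => /andP[? ?]; rewrite !ler0_norm//; lra.
have -> : f (u + x) - f u - x * df u = (df c - df u) * x by rewrite fc; ring.
rewrite normrM; split.
  rewrite ler_wpM2r// (le_trans (ler_normB _ _))//.
  by have := fB c; have := fB u; lra.
have -> : K * x ^+ 2 = (K * `|x|) * `|x| by rewrite -real_normK ?num_real//; ring.
by rewrite ler_wpM2r// (le_trans (fK _ _))// ler_wpM2l.
Qed.

(** The integrand of Lindeberg's condition. *)
Definition tailsq (delta x : R) : R := if delta < `|x| then x ^+ 2 else 0.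

Lemma tailsq_ge0 delta x : 0 <= tailsq delta x.
Proof. by rewrite /tailsq; case: ifP => // _; exact: sqr_ge0. Qed.

Lemma tailsq_le delta x : tailsq delta x <= x ^+ 2.
Proof. by rewrite /tailsq; case: ifP => // _; exact: sqr_ge0. Qed.

Lemma measurable_tailsq delta : measurable_fun setT (tailsq delta).
Proof.
apply: measurable_fun_ifT => //=.
by apply: measurable_fun_ltr => //; exact: normr_measurable.
Qed.

End taylor.

(** * Stein's method for a sum of independent centered variables *)

Section stein_lindeberg.
Context {d : measure_display} {T : measurableType d} {R : realType}
  (P : probability T R).
Local Notation E := (Ex P).
Local Notation intg := (intg P).

(** Independence is recorded in leave-one-out form, each summand against the sum of the others,
    which is how the expansion in [stein_step] uses it. *)
Record normalized_sum {I : eqType} (J : seq I) (xi : I -> T -> R) : Prop := {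
  ns_measurable : forall k, measurable_fun setT (xi k) ;
  ns_sqr : forall k, intg (fun w => xi k w ^+ 2) ;
  ns_mean : forall k, E (xi k) = 0 ;
  ns_indep : forall k, k \in J ->
    indep2 P (xi k) (fun w => \sum_(j <- rem k J) xi j w) ;
  ns_var : \sum_(k <- J) E (fun w => xi k w ^+ 2) = 1 }.

Definition lindeberg {I : eqType} (J : seq I) (xi : I -> T -> R) (delta : R) :=
  \sum_(k <- J) E (fun w => tailsq delta (xi k w)).

Lemma intg_sqr (U : T -> R) : measurable_fun setT U ->
  intg (fun w => U w ^+ 2) -> intg U.
Proof.
move=> mU iU; apply: (@intg_le _ _ _ P U (fun w => 1 + U w ^+ 2)) => //.
  by apply: intgD => //; exact: intg_cst.
move=> w; rewrite -(real_normK (num_real (U w))).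
have := sqr_ge0 (`|U w| - 1); have := normr_ge0 (U w) => *; nra.
Qed.

Context {I : eqType} (J : seq I) (xi : I -> T -> R) (N : normalized_sum J xi).
Context (f df : R -> R) (B K : R).
Hypothesis fd : forall x : R, is_derive x 1 f (df x).
Hypothesis fB : forall x, `|f x| <= B.
Hypothesis dfB : forall x, `|df x| <= B.
Hypothesis dfK : forall x y, `|df x - df y| <= K * `|x - y|.
Hypothesis K0 : 0 <= K.

Let W w := \sum_(k <- J) xi k w.

(** Write W = V + xi_k with V independent of xi_k. In the expansion of xi_k f(W) around V, the term
    xi_k f(V) has mean 0 and xi_k^2 f'(V) has mean E xi_k^2 E f'(V). What remains is the Taylor
    remainder [r] and the replacement of f'(V) by f'(W), measured by [q]. *)
Lemma stein_step k delta : k \in J -> 0 < delta ->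
  `|E (fun w => xi k w * f (W w)) - E (fun w => xi k w ^+ 2) * E (df \o W)| <=
  2 * K * delta * E (fun w => xi k w ^+ 2) +
  (2 * B + K / delta) * E (fun w => tailsq delta (xi k w)).
Proof.
move=> kJ d0.
set s2 := E (fun w => xi k w ^+ 2); set l := E (fun w => tailsq delta (xi k w)).
pose V w := \sum_(j <- rem k J) xi j w.
have mxi := ns_measurable N.
have WV w : W w = V w + xi k w by rewrite /W (big_rem k kJ)/= addrC.
have mV : measurable_fun setT V by exact: measurable_sum.
have mW : measurable_fun setT W by exact: measurable_sum.
have cf : continuous f := is_derive_continuous fd.
have cdf : continuous df := lipschitz_continuous dfK.
have mf : measurable_fun setT f by exact: continuous_measurable_fun.
have mdf : measurable_fun setT df by exact: continuous_measurable_fun.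
have ixi2 := ns_sqr N k.
have ixi := intg_sqr (mxi k) ixi2.
have il : intg (fun w => tailsq delta (xi k w)).
  apply: (@intg_le _ _ _ P _ (fun w => xi k w ^+ 2)) => //.
    by apply: measurableT_comp; [exact: measurable_tailsq|].
  by move=> w; rewrite ger0_norm ?tailsq_ge0// tailsq_le.
have ifV : intg (f \o V).
  by apply: (@intg_bounded _ _ _ P _ B) => [|w]; [exact: measurableT_comp|exact: fB].
have idV : intg (df \o V).
  by apply: (@intg_bounded _ _ _ P _ B) => [|w]; [exact: measurableT_comp|exact: dfB].
have idW : intg (df \o W).
  by apply: (@intg_bounded _ _ _ P _ B) => [|w]; [exact: measurableT_comp|exact: dfB].
have ind := ns_indep N kJ.
have msq : measurable_fun setT (fun x : R => x ^+ 2) by exact: exprn_measurable.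
have [i1 e1] := indep2_mul
  (indep2_comp (f := id) (g := f) (@measurable_id _ _ _) mf ind) ixi ifV.
have [i2 e2] := indep2_mul (indep2_comp (g := df) msq mdf ind) ixi2 idV.
rewrite /= in i1 e1 i2 e2.
have B0 : 0 <= B := le_trans (normr_ge0 _) (fB 0).
pose r w := xi k w * (f (W w) - f (V w) - xi k w * df (V w)).
have mr : measurable_fun setT r.
  apply: measurable_funM => //; apply: measurable_funB.
    by apply: measurable_funB; exact: measurableT_comp.
  by apply: measurable_funM => //; exact: measurableT_comp.
have rle w : `|r w| <= K * delta * xi k w ^+ 2 + 2 * B * tailsq delta (xi k w).
  rewrite /r WV normrM; set x := xi k w.
  have [t1 t2] := taylor1_lipschitz fd dfB dfK K0 (V w) x.
  have x2 : x ^+ 2 = `|x| ^+ 2 by rewrite real_normK ?num_real.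
  rewrite /tailsq; case: (ltP delta `|x|) => dx.
    have : `|x| * `|f (V w + x) - f (V w) - x * df (V w)| <= `|x| * (2 * B * `|x|).
      by rewrite ler_wpM2l.
    have : 0 <= K * delta * x ^+ 2.
      by rewrite mulr_ge0 ?sqr_ge0// mulr_ge0// ltW.
    by rewrite x2; move=> *; lra.
  have : `|x| * `|f (V w + x) - f (V w) - x * df (V w)| <= delta * (K * x ^+ 2).
    by rewrite ler_pM.
  by lra.
have irb : intg (fun w => K * delta * xi k w ^+ 2 + 2 * B * tailsq delta (xi k w)).
  by apply: intgD; exact: intgZ.
have ir : intg r by exact: intg_le irb rle.
have Er : `|E r| <= K * delta * s2 + 2 * B * l.
  apply: (le_trans (Ex_norm_le ir irb rle)).
  by rewrite ExD ?ExZ//; exact: intgZ.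
(* Since f' is Lipschitz, [|q|] is at most K |xi_k|, and |x| <= delta + x^2 / delta, where the last
   term is present only if |x| > delta. *)
pose q w := df (V w) - df (W w).
have qle w : `|q w| <= K * delta + K / delta * tailsq delta (xi k w).
  rewrite /q (le_trans (dfK _ _))// WV opprD addrA subrr sub0r normrN.
  set x := xi k w; rewrite -mulrA -mulrDr ler_wpM2l//.
  rewrite /tailsq; case: (ltP delta `|x|) => dx.
    have : `|x| <= delta^-1 * x ^+ 2.
      rewrite ler_pdivlMl// -[in leRHS](real_normK (num_real x)) expr2.
      by rewrite ler_wpM2r// ltW.
    lra.
  by rewrite mulr0 addr0.
have iqb : intg (fun w => K * delta + K / delta * tailsq delta (xi k w)).
  by apply: intgD; [exact: intg_cst|exact: intgZ].
have iq : intg q by exact: intgB.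
have Eq : `|E (df \o V) - E (df \o W)| <= K * delta + K / delta * l.
  rewrite -ExB//; apply: (le_trans (Ex_norm_le iq iqb qle)).
  rewrite (@ExD _ _ _ P (cst (K * delta))); [|exact: intg_cst|exact: intgZ].
  by rewrite ExZ// Ex_cst.
have eE : E (fun w => xi k w * f (W w)) = E r + s2 * E (df \o V).
  have -> : (fun w => xi k w * f (W w)) =
      (fun w => (r w + xi k w * f (V w)) + xi k w ^+ 2 * df (V w)).
    by apply/funext => w; rewrite /r; ring.
  rewrite ExD//; last exact: intgD.
  by rewrite ExD// e1 e2 (ns_mean N k) mul0r addr0.
have s20 : 0 <= s2 by apply: Ex_ge0 => w; exact: sqr_ge0.
(* A single variance is at most the total variance 1; this removes the factor [s2] in front of the
   Lindeberg term. *)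
have s21 : s2 <= 1.
  rewrite -(ns_var N) (big_rem k kJ)/= lerDl sumr_ge0// => j _.
  by apply: Ex_ge0 => w; exact: sqr_ge0.
have l0 : 0 <= l by apply: Ex_ge0 => w; exact: tailsq_ge0.
rewrite eE -addrA -mulrBr (le_trans (ler_normD _ _))// normrM (ger0_norm s20).
have : s2 * `|E (df \o V) - E (df \o W)| <= s2 * (K * delta + K / delta * l).
  by rewrite ler_wpM2l.
have : s2 * (K / delta * l) <= K / delta * l.
  by rewrite ler_piMl// mulr_ge0// divr_ge0// ltW.
move: Er; set u := `|_|; set v := `|_|; set z := K / delta * l => *.
have -> : (2 * B + K / delta) * l = 2 * B * l + z by rewrite /z; ring.
lra.
Qed.

(** As the variances add up to 1, E f'(W) splits into the parts E xi_k^2 E f'(W), and each part is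
    matched with E xi_k f(W) by [stein_step]. *)
Lemma stein_sum delta : 0 < delta ->
  `|E (fun w => df (W w) - W w * f (W w))| <=
  2 * K * delta + (2 * B + K / delta) * lindeberg J xi delta.
Proof.
move=> d0.
have mxi := ns_measurable N.
have mW : measurable_fun setT W by exact: measurable_sum.
have cf : continuous f := is_derive_continuous fd.
have cdf : continuous df := lipschitz_continuous dfK.
have mf : measurable_fun setT f by exact: continuous_measurable_fun.
have mdf : measurable_fun setT df by exact: continuous_measurable_fun.
have idW : intg (df \o W).
  by apply: (@intg_bounded _ _ _ P _ B) => [|w]; [exact: measurableT_comp|exact: dfB].
have ixf k : intg (fun w => xi k w * f (W w)).
  apply: (@intg_le _ _ _ P _ (fun w => B * `|xi k w|)).
  - by apply: measurable_funM => //; exact: measurableT_comp.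
  - by apply: intgZ; apply: intg_norm; apply: intg_sqr => //; exact: (ns_sqr N).
  - by move=> w; rewrite normrM mulrC ler_wpM2r.
have -> : E (fun w => df (W w) - W w * f (W w)) =
    \sum_(k <- J) (E (fun w => xi k w ^+ 2) * E (df \o W) -
                   E (fun w => xi k w * f (W w))).
  rewrite sumrB -mulr_suml (ns_var N) mul1r -Ex_sum// -ExB//; last exact: intg_sum.
  by congr Ex; apply/funext => w; rewrite /= mulr_suml.
rewrite (le_trans (ler_norm_sum _ _ _))//.
rewrite (@le_trans _ _ (\sum_(k <- J) (2 * K * delta * E (fun w => xi k w ^+ 2) +
   (2 * B + K / delta) * E (fun w => tailsq delta (xi k w)))))//.
  rewrite big_seq [leRHS]big_seq; apply: ler_sum => k kJ.
  by rewrite distrC; exact: stein_step.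
by rewrite big_split/= -!mulr_sumr (ns_var N) mulr1.
Qed.

End stein_lindeberg.

(** * Lindeberg's central limit theorem along a filter *)

Section lindeberg_clt.
Context {d : measure_display} {T : measurableType d} {R : realType}
  (P : probability T R).

Lemma ramp_cdf (W : T -> R) (a b : R) : a < b -> measurable_fun setT W ->
  fine (P [set w | W w <= a]) <= Ex P (ramp a b \o W) /\
  Ex P (ramp a b \o W) <= fine (P [set w | W w <= b]).
Proof.
move=> ab mW.
have mA c : measurable [set w | W w <= c].
  rewrite -[X in measurable X]setTI.
  have -> : [set w | W w <= c] = W @^-1` `]-oo, c] by rewrite set_itvE.
  exact: mW.
have PE c : fine (P [set w | W w <= c]) = Ex P \1_[set w | W w <= c].
  by rewrite /Ex expectation_indic.
have iI c : intg P \1_[set w | W w <= c].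
  by apply: (@intg_bounded _ _ _ P _ 1) => // w; rewrite indicE; case: (_ \in _);
    rewrite ?normr1 ?normr0.
have mr : measurable_fun setT (ramp a b).
  by apply: continuous_measurable_fun; exact: continuous_ramp.
have ir : intg P (ramp a b \o W).
  apply: (@intg_bounded _ _ _ P _ 1) => [|w]; first exact: measurableT_comp.
  by rewrite /= ger0_norm ?ramp_ge0 ?ramp_le1.
rewrite !PE; split; apply: Ex_le => // w; rewrite indicE /=.
  case: (boolP (w \in _)) => [|_]; last by rewrite ramp_ge0.
  by rewrite inE/= => /ramp_left ->.
case: (boolP (w \in _)) => [_|]; first by rewrite ramp_le1.
by rewrite notin_setE/= => /negP; rewrite -ltNge => /ltW /ramp_right ->.
Qed.

(* Stein's equation [dstein x - x * stein x = ramp a b x - ramp_mean a b]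
   turns the Stein bound into a bound on smoothed distribution functions. *)
Lemma ramp_clt (a b : R) : a < b -> exists2 C, 0 <= C &
  forall (I : eqType) (J : seq I) (xi : I -> T -> R) (delta : R),
    normalized_sum P J xi -> 0 < delta ->
  `|Ex P (fun w => ramp a b (\sum_(k <- J) xi k w)) - ramp_mean a b| <=
  C * delta + C * (1 + delta^-1) * lindeberg P J xi delta.
Proof.
move=> ab; have [B sB] := stein_bounded ab; have [K sK] := stein_lipschitz ab.
have B0 : 0 <= B by have [+ _ _] := sB 0; exact: le_trans.
have K0 : 0 <= `|K| by [].
(* Large enough for both terms of [stein_sum]: it dominates [2 * |K|], and its product with
   [1 + delta^-1] dominates [2 * B + |K| / delta]. *)
exists (2 * B + 2 * `|K|) => [|I J xi delta N d0]; first lra.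
have s1 x : `|stein a b x| <= B by case: (sB x).
have s2 x : `|dstein a b x| <= B by case: (sB x).
have s3 x y : `|dstein a b x - dstein a b y| <= `|K| * `|x - y|.
  by rewrite (le_trans (sK x y))// ler_wpM2r// ler_norm.
have := stein_sum N (is_derive_stein ab) s1 s2 s3 K0 d0.
set W := fun w => \sum_(k <- J) xi k w.
have -> : (fun w => dstein a b (W w) - W w * stein a b (W w)) =
    (fun w => ramp a b (W w) - cst (ramp_mean a b) w).
  by apply/funext => w; rewrite /dstein/=; ring.
have mW : measurable_fun setT W by apply: measurable_sum; exact: ns_measurable N.
have mr : measurable_fun setT (ramp a b).
  by apply: continuous_measurable_fun; exact: continuous_ramp.
have ir : intg P (fun w => ramp a b (W w)).
  apply: (@intg_bounded _ _ _ P _ 1) => [|w]; first exact: measurableT_comp.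
  by rewrite /= ger0_norm ?ramp_ge0 ?ramp_le1.
rewrite ExB//; last exact: intg_cst.
rewrite Ex_cst => /le_trans; apply.
have l0 : 0 <= lindeberg P J xi delta.
  by apply: sumr_ge0 => k _; apply: Ex_ge0 => w; exact: tailsq_ge0.
have dV : 0 < delta^-1 by rewrite invr_gt0.
apply: lerD; first by apply: ler_wpM2r; [exact: ltW|lra].
by apply: ler_wpM2r => //; have := mulr_ge0 B0 (ltW dV);
  have := mulr_ge0 K0 (ltW dV); lra.
Qed.

(** The distribution function at [t] is enclosed between a ramp ending at [t] and a ramp starting at
    [t]. Their width is fixed first, by continuity of [Gauss], at a cost of [e / 2]; with the width
    fixed, the constant of [ramp_clt] is fixed too, and [delta] and then [u] are chosen to keep its
    bound below the other [e / 2]. *)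
Lemma lindeberg_clt {U : Type} (F : set_system U) {FF : ProperFilter F}
    (I : eqType) (J : U -> seq I) (xi : U -> I -> T -> R) (t : R) :
  (\forall u \near F, normalized_sum P (J u) (xi u)) ->
  (forall delta, 0 < delta ->
    lindeberg P (J u) (xi u) delta @[u --> F] --> (0 : R)) ->
  fine (P [set w | \sum_(k <- J u) xi u k w <= t]) @[u --> F] --> Gauss t.
Proof.
move=> NF LF; apply/cvgrPdist_le => e e0.
have ramp_near a b r : a < b -> 0 < r -> \forall u \near F,
    `|Ex P (fun w => ramp a b (\sum_(k <- J u) xi u k w)) - ramp_mean a b| <= r.
  move=> ab r0; have [C C0 HC] := ramp_clt ab.
  have r2 : 0 <= r / 2 by rewrite divr_ge0// ltW.
  (* Applied to [C] for the choice of [delta], then to [D] for the Lindeberg sum; the [+ 1] takes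
     care of a constant equal to 0. *)
  have shrink y : 0 <= y -> y * (r / 2 / (y + 1)) <= r / 2.
    move=> y0; rewrite mulrCA ler_piMr// ler_pdivrMr ?ltr_wpDl//.
    by rewrite mul1r lerDl.
  pose delta := r / 2 / (C + 1).
  have d0 : 0 < delta by rewrite !divr_gt0// ltr_wpDl.
  have Cd : C * delta <= r / 2 by exact: shrink.
  set D := C * (1 + delta^-1).
  have D0 : 0 <= D by rewrite mulr_ge0// addr_ge0// invr_ge0 ltW.
  have /cvgrPdist_le/(_ (r / 2 / (D + 1))) L := LF _ d0.
  near=> u.
  have N : normalized_sum P (J u) (xi u) by near: u.
  apply: (le_trans (HC _ _ _ _ N d0)); rewrite -/D.
  have : `|0 - lindeberg P (J u) (xi u) delta| <= r / 2 / (D + 1).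
    by near: u; apply: L; rewrite !divr_gt0// ltr_wpDl.
  rewrite sub0r normrN => /(le_trans (ler_norm _)) Lu.
  have : D * lindeberg P (J u) (xi u) delta <= r / 2.
    by apply: (le_trans (ler_wpM2l D0 Lu)); exact: shrink.
  lra.
have cG : continuous (@Gauss R) := is_derive_continuous (@is_derive_Gauss R).
have /cvgrPdist_lt/(_ (e / 2)) := cG t.
rewrite divr_gt0// => /(_ isT) /nbhs_ballP[eta /= eta0 Heta].
have eta2 : 0 < eta / 2 by rewrite divr_gt0.
have Gp : `|Gauss t - Gauss (t + eta / 2)| < e / 2.
  by apply: Heta; rewrite /ball/= opprD addrA subrr sub0r normrN gtr0_norm//; lra.
have Gm : `|Gauss t - Gauss (t - eta / 2)| < e / 2.
  by apply: Heta; rewrite /ball/= opprB addrC subrK gtr0_norm//; lra.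
have tp : t < t + eta / 2 by lra.
have tm : t - eta / 2 < t by lra.
have e2 : 0 < e / 2 by rewrite divr_gt0.
near=> u.
have N : normalized_sum P (J u) (xi u) by near: u.
have mW : measurable_fun setT (fun w => \sum_(k <- J u) xi u k w).
  by apply: measurable_sum; exact: ns_measurable N.
have Rp : `|Ex P (fun w => ramp t (t + eta / 2) (\sum_(k <- J u) xi u k w)) -
    ramp_mean t (t + eta / 2)| <= e / 2 by near: u; exact: ramp_near.
have Rm : `|Ex P (fun w => ramp (t - eta / 2) t (\sum_(k <- J u) xi u k w)) -
    ramp_mean (t - eta / 2) t| <= e / 2 by near: u; exact: ramp_near.
have [Pp _] := ramp_cdf tp mW; have [_ Pm] := ramp_cdf tm mW.
rewrite /comp in Pp Pm.
have mp := ramp_mean_le tp; have mm := ramp_mean_ge tm.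
move: Gp Gm Rp Rm; rewrite !ltr_norml !ler_norml => /andP[? ?] /andP[? ?]
  /andP[? ?] /andP[? ?].
by apply/andP; split; lra.
Unshelve. all: by end_near. Qed.

End lindeberg_clt.

(** * Dominated convergence for sums of varying length *)

Section tannery.
Context {R : realType}.

Lemma geometric_sum_le (rho : R) m : 0 <= rho -> rho < 1 ->
  \sum_(i < m) rho ^+ i <= (1 - rho)^-1.
Proof.
move=> r0 r1; have d0 : 0 < 1 - rho by lra.
rewrite -[leRHS]mul1r ler_pdivlMr//.
have -> : (\sum_(i < m) rho ^+ i) * (1 - rho) = 1 - rho ^+ m.
  by rewrite -(opprB rho) -(opprB (rho ^+ m)) subrX1; ring.
by rewrite gerBl exprn_ge0.
Qed.

(** The cut [N] is chosen from the geometric bound alone, so that the terms beyond it add up to at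
    most [e / 2] whatever the length [n u]; the head then has a fixed number of terms. *)
Lemma tannery {U : Type} (F : set_system U) {FF : Filter F}
    (a : U -> nat -> R) (n : U -> nat) (D rho : R) :
  0 <= rho -> rho < 1 ->
  (\forall u \near F, forall l, 0 <= a u l <= D * rho ^+ l) ->
  (forall l, a u l @[u --> F] --> (0 : R)) ->
  \sum_(l < n u) a u l @[u --> F] --> (0 : R).
Proof.
move=> r0 r1 dom lim0; apply/cvgr0Pnorm_le => e e0.
have d0 : 0 < 1 - rho by lra.
have [N HN] : exists N, `|D| * rho ^+ N / (1 - rho) <= e / 2.
  have := @cvg_expr R rho; rewrite ger0_norm// => /(_ r1) /cvgr0Pnorm_le.
  set e' := e / 2 * (1 - rho) / (`|D| + 1).
  have D1 : 0 < `|D| + 1 by rewrite ltr_wpDl.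
  have e'0 : 0 < e' by rewrite divr_gt0// mulr_gt0// divr_gt0.
  move=> /(_ e' e'0)[N _ /(_ N (leqnn _))]/=.
  rewrite ger0_norm ?exprn_ge0// => rN; exists N.
  rewrite ler_pdivrMr//; have := exprn_ge0 N r0 => rN0.
  rewrite (@le_trans _ _ ((`|D| + 1) * rho ^+ N))//.
    by rewrite ler_wpM2r// lerDl.
  by rewrite mulrC -ler_pdivlMr.
have cN : \sum_(l < N) a u l @[u --> F] --> (0 : R).
  elim: N {HN} => [|N IH].
    by under eq_fun do rewrite big_ord0; exact: cvg_cst.
  have -> : (fun u => \sum_(l < N.+1) a u l) =
      (fun u => \sum_(l < N) a u l) \+ a ^~ N.
    by apply/funext => u; rewrite big_ord_recr.
  by have := cvgD IH (lim0 N); rewrite addr0; apply.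
near=> u.
have domu : forall l, 0 <= a u l <= D * rho ^+ l by near: u.
have sN : \sum_(l < N) a u l <= e / 2.
  rewrite (le_trans (ler_norm _))//; near: u.
  by move/cvgr0Pnorm_le : cN; apply; rewrite divr_gt0.
have a0 l : 0 <= a u l by case/andP: (domu l).
rewrite ger0_norm ?sumr_ge0//.
(* The length [n u] may be smaller than [N]; adding nonnegative terms makes the split at [N]
   possible in every case. *)
rewrite (@le_trans _ _ (\sum_(l < N + n u) a u l))//.
  by rewrite addnC big_split_ord/= lerDl sumr_ge0.
rewrite big_split_ord/= (_ : e = e / 2 + e / 2); last by field.
rewrite lerD//; apply: le_trans HN.
rewrite -[leRHS]mulrA mulrCA [leRHS]mulrC.
rewrite (@le_trans _ _ (\sum_(i < n u) (`|D| * rho ^+ N) * rho ^+ i))//.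
  apply: ler_sum => i _; have /andP[_ /le_trans] := domu (N + i)%N; apply.
  by rewrite -mulrA -exprD ler_wpM2r ?exprn_ge0// ler_norm.
rewrite -mulr_sumr [leRHS]mulrC mulrA [rho ^+ N * _]mulrC.
by rewrite ler_wpM2l ?geometric_sum_le// mulr_ge0// exprn_ge0.
Unshelve. all: by end_near. Qed.

(** Lets the maximum condition be proved through the convergence of a sum, to which [tannery]
    applies. *)
Lemma bigmax_le_sum (n : nat) (b : nat -> R) : (forall l, 0 <= b l) ->
  0 <= \big[Num.max/0]_(l < n) b l <= \sum_(l < n) b l.
Proof.
elim: n b => [|n IH] b b0; first by rewrite !big_ord0 lexx.
rewrite !big_ord_recl/= le_max b0/= ge_max lerDl sumr_ge0//=.
have /andP[_ /le_trans] := IH (fun l => b l.+1) (fun l => b0 l.+1); apply.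
by rewrite lerDr.
Qed.

End tannery.

(** * Bounds on the rounding that defines levels and sample sizes *)

Section ceil_max1.
Context {R : realType}.
Implicit Types x : R.

Lemma ceil_max1_gt0 x : (0 < ceil_max1 x)%N.
Proof. by rewrite /ceil_max1 leq_max orbT. Qed.

Lemma ceil_max1_ge x : x <= (ceil_max1 x)%:R.
Proof.
rewrite /ceil_max1; have := ceil_ge x; case: (Num.ceil x) => n /= xn.
  by rewrite (le_trans xn)// -pmulrn ler_nat leq_maxl.
by rewrite (le_trans xn)// (@le_trans _ _ 0)// lerz0.
Qed.

Lemma ceil_max1_le x : 0 <= x -> (ceil_max1 x)%:R <= x + 1.
Proof.
move=> x0; rewrite /ceil_max1; have := ceilB1_lt x.
rewrite intrB; case: (Num.ceil x) => n /= nx.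
  rewrite /maxn; case: ifP => _; first by lra.
  by move: nx; rewrite -pmulrn; lra.
by rewrite max0n; lra.
Qed.

End ceil_max1.

(** * Transfer of moments between equal laws, truncated second moments, sums of independent
    variables *)

Section moments.
Context {d : measure_display} {T : measurableType d} {R : realType}
  (P : probability T R).
Local Notation E := (Ex P).
Local Notation intg := (intg P).

Lemma same_law_Ex (Z W : T -> R) (g : R -> R) :
  measurable_fun setT Z -> measurable_fun setT W -> measurable_fun setT g ->
  same_law P Z W -> intg (g \o W) -> intg (g \o Z) /\ E (g \o Z) = E (g \o W).
Proof.
move=> mZ mW mg ZW igW.
pose Z' : {RV P >-> R} := mfun_Sub (mem_set mZ).
pose W' : {RV P >-> R} := mfun_Sub (mem_set mW).
have mg' : measurable_fun setT (EFin \o g) by apply/measurable_EFinP.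
have mng : measurable_fun setT (fun x => `|(g x)%:E|%E).
  by apply: measurableT_comp mg'; exact: abse_measurable.
have law A : measurable A -> A `<=` setT ->
    distribution P Z' A = distribution P W' A.
  by move=> mA _; exact: ZW.
have igZ : intg (g \o Z).
  apply/integrableP; split.
    by apply/measurable_EFinP; exact: measurableT_comp.
  case/integrableP : igW => _; apply: le_lt_trans.
  rewrite -(ge0_integral_distribution Z' (f := fun x => `|(g x)%:E|%E))//.
  rewrite -(ge0_integral_distribution W' (f := fun x => `|(g x)%:E|%E))//.
  by rewrite (eq_measure_integral (distribution P W')).
split => //; rewrite /Ex unlock; congr fine.
rewrite -(integral_distribution (X := Z') mg')//.
rewrite -(integral_distribution (X := W') mg')//.
by rewrite (eq_measure_integral (distribution P W')).
Qed.

Lemma Ex_tailsq_cvg0 (U : T -> R) : measurable_fun setT U ->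
  intg (fun w => U w ^+ 2) ->
  E (fun w => tailsq n%:R (U w)) @[n --> \oo] --> (0 : R).
Proof.
move=> mU iU; rewrite /Ex unlock; apply: fine_cvg.
rewrite [X in _ --> X](_ : _ = \int[P]_w (cst (0 : R) w)%:E)%E; last first.
  by rewrite integral0.
apply: (dominated_cvg measurableT (g := fun w => (U w ^+ 2)%:E)) => //.
- move=> n; apply/measurable_EFinP.
  by apply: measurableT_comp => //; exact: measurable_tailsq.
- move=> w _; apply: cvg_near_cst; near=> n.
  rewrite /tailsq ltNge (_ : (_ <= _) = true)//.
  by near: n; exact: nbhs_infty_ger.
- move=> n w _ /=; rewrite lee_fin ger0_norm ?tailsq_ge0//.
  exact: tailsq_le.
Unshelve. all: by end_near. Qed.

Lemma tailsq_le_tail (r s x : R) : r <= s -> tailsq s x <= tailsq r x.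
Proof.
move=> rs; rewrite {1}/tailsq; case: ifP => [sx|_]; last exact: tailsq_ge0.
by rewrite /tailsq (le_lt_trans rs sx).
Qed.

Lemma tailsq_div (delta m x : R) : 0 < m ->
  tailsq delta (x / m) = tailsq (delta * m) x / m ^+ 2.
Proof.
move=> m0; rewrite /tailsq normrM normfV (gtr0_norm m0) ltr_pdivlMr//.
by case: ifP => _; rewrite ?mul0r// expr_div_n.
Qed.

Lemma intg_tailsq r (U : T -> R) : measurable_fun setT U ->
  intg (fun w => U w ^+ 2) -> intg (fun w => tailsq r (U w)).
Proof.
move=> mU iU; apply: (intg_le _ iU).
  by apply: measurableT_comp => //; exact: measurable_tailsq.
by move=> w; rewrite ger0_norm ?tailsq_ge0// tailsq_le.
Qed.

(** Bienaymé's identity. In the induction the cross term of the new summand with the rest has mean 0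
    by [indep2_sum] and centering. *)
Lemma sum_indep_sqr {I : eqType} (Y : I -> {RV P >-> R}) (g : I -> R -> R)
    (J : seq I) : mutually_independent (P := P) Y ->
  (forall k, measurable_fun setT (g k)) ->
  (forall k, intg (fun w => g k (Y k w) ^+ 2)) ->
  (forall k, E (fun w => g k (Y k w)) = 0) -> uniq J ->
  intg (fun w => (\sum_(k <- J) g k (Y k w)) ^+ 2) /\
  E (fun w => (\sum_(k <- J) g k (Y k w)) ^+ 2) =
  \sum_(k <- J) E (fun w => g k (Y k w) ^+ 2).
Proof.
move=> indY mg ig2 g0.
have mgY k : measurable_fun setT (fun w => g k (Y k w)) by exact: measurableT_comp.
have ig k : intg (fun w => g k (Y k w)) by exact: intg_sqr.
elim: J => [_|k J IH /[dup] uJ /= /andP[kJ uJ']].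
  rewrite big_nil; have -> : (fun w : T =>
      (\sum_(k <- [::]) g k (Y k w)) ^+ 2) = cst 0.
    by apply/funext => w; rewrite big_nil expr0n.
  by rewrite Ex_cst; split => //; exact: intg_cst.
have [iS eS] := IH uJ'; set S := fun w => \sum_(k <- J) g k (Y k w).
have iS1 : intg S by exact: intg_sum.
have indS := indep2_comp (f := g k) (g := id) (mg k) (@measurable_id _ _ _)
  (indep2_sum indY mg uJ).
have [i1 e1] := indep2_mul indS (ig k) iS1.
rewrite /= -/S in i1 e1.
have -> : (fun w => (\sum_(k <- k :: J) g k (Y k w)) ^+ 2) =
    (fun w => (g k (Y k w) ^+ 2 + 2 * (g k (Y k w) * S w)) + S w ^+ 2).
  by apply/funext => w; rewrite big_cons /S; ring.
rewrite big_cons -eS; split.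
  by apply: intgD => //; apply: intgD => //; exact: intgZ.
rewrite ExD//; last by apply: intgD => //; exact: intgZ.
rewrite ExD//; last exact: intgZ.
by rewrite ExZ// e1 g0 mul0r mulr0 addr0.
Qed.

Lemma fine_varianceE (U : T -> R) :
  fine 'V_P[U] = E (fun w => (U w - E U) ^+ 2).
Proof.
by rewrite /variance unlock /Ex; congr (fine 'E_P[_]).
Qed.

End moments.

(** * The estimator as a normalized sum, and its asymptotics *)

Section mlmc_clt.
Context {d : measure_display} {T : measurableType d} {R : realType}
  (P : probability T R).
Context (Xs : nat -> {RV P >-> R}) (Cst : nat -> R)
  (Y : nat -> nat -> {RV P >-> R}) (alpha beta gamma calpha C c C' : R).
Local Notation Xf := (fun k => Xs k : T -> R).
Hypothesis X2 : forall l, (Xs l : T -> R) \in Lfun P 2%:E.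
Hypothesis C0 : 0 < C.
Hypothesis c0 : 0 < c.
Hypothesis Vle : forall l : nat, Vl P Xf l <= C * expR (- beta * l%:R).
Hypothesis Cle : forall l : nat,
  c * expR (gamma * l%:R) < Cst l /\ Cst l < C' * expR (gamma * l%:R).
Hypothesis indY : mutually_independent (P := P) (fun li : nat * nat => Y li.1 li.2).
Hypothesis lawY : forall l i, same_law P (Y l i) (DeltaX Xf l).
Hypothesis gb : gamma < beta.
Hypothesis V0 : 0 < Vl P Xf 0.

Local Notation E := (Ex P).
Local Notation intg := (intg P).
Let A := AML P Xf Cst alpha calpha (fun l i => Y l i : T -> R).
Let L := Leps alpha calpha.
Let M := Mleps P Xf Cst alpha calpha.
Let VarA eps := fine 'V_P[A eps].
Let v := Vl P Xf.
Let D := DeltaX Xf.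
Let m l := E (D l).

Lemma Cst_gt0 l : 0 < Cst l.
Proof. by have [+ _] := Cle l; apply: le_lt_trans; rewrite mulr_ge0 ?expR_ge0// ltW. Qed.

Lemma DeltaX_Lfun l : D l \in Lfun P 2%:E.
Proof.
case: l => [|l]; first exact: X2.
by rewrite /D/= rpredB ?lee1n//= => *; exact: X2.
Qed.

Lemma measurable_DeltaX l : measurable_fun setT (D l).
Proof. by case: l => [|l] //; apply: measurable_funB. Qed.

Lemma intg_DeltaX_sqr l : intg (fun w => D l w ^+ 2).
Proof. exact: Lfun2_integrable_sqr (DeltaX_Lfun l). Qed.

Lemma intg_DeltaX l : intg (D l).
Proof. exact: intg_sqr (measurable_DeltaX l) (intg_DeltaX_sqr l). Qed.

Lemma intg_centered_sqr l : intg (fun w => (D l w - m l) ^+ 2).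
Proof.
have -> : (fun w => (D l w - m l) ^+ 2) =
    (fun w => (D l w ^+ 2 - 2 * m l * D l w) + cst (m l ^+ 2) w).
  by apply/funext => w; rewrite /=; ring.
apply: intgD; last exact: intg_cst.
apply: intgB; first exact: intg_DeltaX_sqr.
by apply: intgZ; exact: intg_DeltaX.
Qed.

Lemma VlE l : v l = E (fun w => (D l w - m l) ^+ 2).
Proof. exact: fine_varianceE. Qed.

Lemma Vl_ge0 l : 0 <= v l.
Proof. by rewrite VlE; apply: Ex_ge0 => w; exact: sqr_ge0. Qed.

Lemma Ex_telescope n : \sum_(l < n.+1) m l = E (Xs n).
Proof.
have iX k : intg (Xs k).
  by apply: intg_sqr => //; exact: Lfun2_integrable_sqr (X2 k).
elim: n => [|n IH]; first by rewrite big_ord_recl big_ord0 addr0.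
rewrite big_ord_recr/= IH /m /D/=.
by rewrite (ExB (iX n.+1) (iX n)); ring.
Qed.

Definition tail l r := E (fun w => tailsq r (D l w - m l)).

Lemma tail_ge0 l r : 0 <= tail l r.
Proof. by apply: Ex_ge0 => w; exact: tailsq_ge0. Qed.

Let measurable_centered l : measurable_fun setT (fun w => D l w - m l).
Proof. by apply: measurable_funB => //; exact: measurable_DeltaX. Qed.

Lemma tail_le_Vl l r : tail l r <= v l.
Proof.
rewrite VlE; apply: Ex_le; [|exact: intg_centered_sqr|].
  by apply: intg_tailsq; [exact: measurable_centered|exact: intg_centered_sqr].
by move=> w; exact: tailsq_le.
Qed.

Lemma tail_le l r s : r <= s -> tail l s <= tail l r.
Proof.
move=> rs; apply: Ex_le.
1,2: by apply: intg_tailsq; [exact: measurable_centered|exact: intg_centered_sqr].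
by move=> w; exact: tailsq_le_tail.
Qed.

Lemma tail_small l e : 0 < e -> exists r0, forall r, r0 <= r -> tail l r <= e.
Proof.
move=> e0; have := Ex_tailsq_cvg0 (measurable_centered l) (intg_centered_sqr l).
move=> /cvgr0Pnorm_le/(_ e e0)[N _ /(_ N (leqnn N))]/= He.
exists N%:R => r Nr; apply: le_trans (tail_le l Nr) _.
exact: le_trans (ler_norm _) He.
Qed.

Lemma sample_moment (g : R -> R) l i : measurable_fun setT g ->
  intg (fun w => g (D l w)) ->
  intg (fun w => g (Y l i w)) /\ E (fun w => g (Y l i w)) = E (fun w => g (D l w)).
Proof.
by move=> mg ig; apply: same_law_Ex => //; exact: measurable_DeltaX.
Qed.

Section scaled.
Context (a : nat -> R).
(** The scaling [a] stays free: it is [M eps l] for the mean and variance of the estimator, and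
    [M eps l] times its standard deviation for the central limit theorem. *)
Let g (k : nat * nat) (x : R) := (x - m k.1) / a k.1.

Lemma measurable_scaled k : measurable_fun setT (g k).
Proof. by apply: measurable_funM => //; apply: measurable_funB. Qed.

Lemma scaledE k w : g k (D k.1 w) = (a k.1)^-1 * (D k.1 w - m k.1).
Proof. by rewrite /g mulrC. Qed.

Lemma scaled_mean k : E (fun w => g k (Y k.1 k.2 w)) = 0.
Proof.
have ic : intg (fun w => D k.1 w - m k.1).
  by apply: intgB; [exact: intg_DeltaX|exact: intg_cst].
have [|_ ->] := @sample_moment (g k) k.1 k.2 (measurable_scaled k).
  by under eq_fun do rewrite scaledE; exact: intgZ.
under eq_fun do rewrite scaledE; rewrite ExZ//.
rewrite (ExB (intg_DeltaX k.1) (intg_cst P (m k.1))) Ex_cst.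
by rewrite subrr mulr0.
Qed.

Lemma scaled_sqr k : intg (fun w => g k (Y k.1 k.2 w) ^+ 2) /\
  E (fun w => g k (Y k.1 k.2 w) ^+ 2) = v k.1 / a k.1 ^+ 2.
Proof.
have mg2 : measurable_fun setT (fun x => g k x ^+ 2).
  by apply: measurable_funX; exact: measurable_scaled.
have e2 : (fun w => g k (D k.1 w) ^+ 2) =
    (fun w => (a k.1) ^- 2 * (D k.1 w - m k.1) ^+ 2).
  by apply/funext => w; rewrite scaledE exprMn exprVn.
have [|i1 ->] := @sample_moment (fun x => g k x ^+ 2) k.1 k.2 mg2.
  by rewrite e2; apply: intgZ; exact: intg_centered_sqr.
split => //; rewrite e2 ExZ; last exact: intg_centered_sqr.
by rewrite VlE mulrC.
Qed.

Lemma scaled_tail k delta : 0 < a k.1 ->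
  E (fun w => tailsq delta (g k (Y k.1 k.2 w))) =
  tail k.1 (delta * a k.1) / a k.1 ^+ 2.
Proof.
move=> a0.
have mt : measurable_fun setT (fun x => tailsq delta (g k x)).
  by apply: measurableT_comp; [exact: measurable_tailsq|exact: measurable_scaled].
have it : intg (fun w => tailsq (delta * a k.1) (D k.1 w - m k.1)).
  by apply: intg_tailsq; [exact: measurable_centered|exact: intg_centered_sqr].
have e2 : (fun w => tailsq delta (g k (D k.1 w))) =
    (fun w => (a k.1) ^- 2 * tailsq (delta * a k.1) (D k.1 w - m k.1)).
  by apply/funext => w; rewrite /g tailsq_div// mulrC.
have [|_ ->] := @sample_moment (fun x => tailsq delta (g k x)) k.1 k.2 mt.
  by rewrite e2; exact: intgZ.
by rewrite e2 ExZ// mulrC.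
Qed.

End scaled.

(** Flattens the double sum of the estimator into one row of a triangular array, indexed by the
    pairs over which independence is assumed. *)
Definition samples eps : seq (nat * nat) :=
  [seq (l, i) | l <- iota 0 (L eps).+1, i <- iota 0 (M eps l)].

Lemma samples_uniq eps : uniq (samples eps).
Proof.
apply: (@allpairs_uniq_dep _ (fun=> nat) _ (fun l i => (l, i))).
- exact: iota_uniq.
  by move=> l _; exact: iota_uniq.
by move=> [l i] [l' i'] _ _ /= [-> ->].
Qed.

Lemma sum_samples eps (f : nat -> nat -> R) :
  \sum_(k <- samples eps) f k.1 k.2 = \sum_(l < (L eps).+1) \sum_(i < M eps l) f l i.
Proof.
rewrite big_allpairs_dep -(big_mkord xpredT (fun l => \sum_(i < M eps l) f l i)).
rewrite /index_iota subn0; apply: eq_bigr => l _.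
by rewrite -(big_mkord xpredT (f l)) /index_iota subn0.
Qed.

Lemma M_gt0 eps l : 0 < (M eps l)%:R :> R.
Proof. by rewrite ltr0n ceil_max1_gt0. Qed.

(** The [M eps l] copies of [m l] on a level cancel the weight 1 / M_l, and the sum of the [m l]
    telescopes. Used with [s = 1] for the moments and with the standard deviation for the normalized
    estimator. *)
Lemma AML_centered eps (s : R) w :
  \sum_(k <- samples eps) (Y k.1 k.2 w - m k.1) / ((M eps k.1)%:R * s) =
  (A eps w - E (Xs (L eps))) / s.
Proof.
rewrite (sum_samples eps (fun l i => (Y l i w - m l) / ((M eps l)%:R * s))).
rewrite -Ex_telescope /A /AML -sumrB mulr_suml; apply: eq_bigr => l _.
rewrite -mulr_suml sumrB sumr_const card_ord -/(M eps l).
rewrite invfM -[m l *+ _]mulr_natr.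
have := M_gt0 eps l; rewrite lt0r => /andP[+ _].
set S := \sum_(i < _) _; move: (M eps l)%:R => n n0.
by rewrite mulrA; congr (_ / s); field.
Qed.

Lemma Ex_AML eps : intg (A eps) /\ E (A eps) = E (Xs (L eps)).
Proof.
pose a l : R := (M eps l)%:R.
have iS k : intg (fun w => (Y k.1 k.2 w - m k.1) / a k.1).
  apply: intg_sqr; last exact: (scaled_sqr a k).1.
  exact: (measurableT_comp (measurable_scaled a k)).
have iSS : intg (fun w => \sum_(k <- samples eps) (Y k.1 k.2 w - m k.1) / a k.1).
  exact: (intg_sum _ _ iS).
have eA w : A eps w = \sum_(k <- samples eps) (Y k.1 k.2 w - m k.1) / a k.1 +
    cst (E (Xs (L eps))) w.
  have := AML_centered eps 1 w; under eq_bigr do rewrite mulr1.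
  by rewrite divr1 => ->; rewrite /= subrK.
have -> : A eps = (fun w => \sum_(k <- samples eps) (Y k.1 k.2 w - m k.1) / a k.1 +
    cst (E (Xs (L eps))) w) by apply/funext => w; exact: eA.
split; first by apply: intgD => //; exact: intg_cst.
rewrite ExD//; last exact: intg_cst.
rewrite Ex_cst Ex_sum// big1 ?add0r// => k _.
exact: (scaled_mean a k).
Qed.

Lemma VarAE eps : VarA eps = \sum_(l < (L eps).+1) v l / (M eps l)%:R.
Proof.
rewrite /VarA fine_varianceE (Ex_AML eps).2; pose a l : R := (M eps l)%:R.
have -> : (fun w => (A eps w - E (Xs (L eps))) ^+ 2) =
    (fun w => (\sum_(k <- samples eps) (Y k.1 k.2 w - m k.1) / a k.1) ^+ 2).
  apply/funext => w; have := AML_centered eps 1 w.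
  by under eq_bigr do rewrite mulr1; rewrite divr1 => ->.
have [_ ->] := sum_indep_sqr indY (measurable_scaled a)
  (fun k => (scaled_sqr a k).1) (scaled_mean a) (samples_uniq eps).
under eq_bigr do rewrite (scaled_sqr a _).2.
rewrite (sum_samples eps (fun l i => v l / a l ^+ 2)); apply: eq_bigr => l _.
rewrite sumr_const card_ord -[LHS]mulr_natr /a.
have := M_gt0 eps l; rewrite lt0r => /andP[+ _].
by move: (M eps l)%:R => n n0; field.
Qed.

Lemma AML_normalized_sum eps : 0 < VarA eps ->
  normalized_sum P (samples eps) (fun k w =>
    (Y k.1 k.2 w - m k.1) / ((M eps k.1)%:R * Num.sqrt (VarA eps))).
Proof.
move=> VA; set s := Num.sqrt _; pose a l : R := (M eps l)%:R * s.
have mg := measurable_scaled a.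
split.
- by move=> k; apply: (measurableT_comp (mg k)).
- by move=> k; exact: (scaled_sqr a k).1.
- by move=> k; exact: (scaled_mean a k).
- move=> k kJ.
  apply: (indep2_comp (g := id) (mg k) (@measurable_id _ _ _)
    (indep2_sum indY mg _)).
  rewrite /= rem_uniq ?samples_uniq// andbT.
  by rewrite (mem_rem_uniq _ (samples_uniq eps)) !inE eqxx.
- under eq_bigr do rewrite (scaled_sqr a _).2.
  rewrite (sum_samples eps (fun l i => v l / a l ^+ 2)).
  transitivity (VarA eps / s ^+ 2); last first.
    by rewrite sqr_sqrtr ?divff ?gt_eqF// ltW.
  rewrite {1}VarAE mulr_suml; apply: eq_bigr => l _.
  rewrite sumr_const card_ord -[LHS]mulr_natr /a exprMn invfM.
  have := M_gt0 eps l; rewrite lt0r => /andP[+ _].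
  move: (M eps l)%:R => n n0; field.
  by rewrite n0 gt_eqF// sqrtr_gt0.
Qed.

(** The [M eps l] samples of a level have equal tails and cancel one factor of the squared scaling.
    The summand is the share v_l / (M_l Var A) of the level, with its variance replaced by a
    truncated one. *)
Lemma AML_lindeberg eps delta : 0 < VarA eps ->
  lindeberg P (samples eps) (fun k w =>
    (Y k.1 k.2 w - m k.1) / ((M eps k.1)%:R * Num.sqrt (VarA eps))) delta =
  \sum_(l < (L eps).+1) tail l (delta * ((M eps l)%:R * Num.sqrt (VarA eps))) /
     ((M eps l)%:R * VarA eps).
Proof.
move=> VA; set s := Num.sqrt _; pose a l : R := (M eps l)%:R * s.
have s0 : 0 < s by rewrite sqrtr_gt0.
have a0 l : 0 < a l by rewrite mulr_gt0// M_gt0.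
rewrite /lindeberg; under eq_bigr do rewrite (scaled_tail delta (a0 _)).
rewrite (sum_samples eps (fun l i => tail l (delta * a l) / a l ^+ 2)).
apply: eq_bigr => l _; rewrite sumr_const card_ord -[LHS]mulr_natr /a.
rewrite -(sqr_sqrtr (ltW VA)) -/s exprMn.
have := M_gt0 eps l; rewrite lt0r => /andP[+ _].
move: (M eps l)%:R => n n0; field.
by rewrite n0 gt_eqF.
Qed.

(** * Bounds on sample sizes, on the variance and on the share of each level *)

Let q l := Num.sqrt (v l * Cst l).
Let x l := Num.sqrt (v l / Cst l).
(** The ratio at which sqrt(V_l C_l) decays: V_l C_l decays with exponent [beta - gamma], halved by
    the square root. *)
Let rho := expR (- ((beta - gamma) / 2)).
Let S eps := Sk P Xf Cst (L eps).

Lemma rho_gt0 : 0 < rho. Proof. exact: expR_gt0. Qed.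

Lemma rho_lt1 : rho < 1.
Proof. by rewrite /rho expR_lt1 oppr_lt0 divr_gt0// subr_gt0. Qed.

Lemma q_le l : q l <= Num.sqrt (C * C') * rho ^+ l.
Proof.
have rl : 0 <= rho ^+ l by rewrite exprn_ge0// ltW// rho_gt0.
rewrite -[X in _ * X]ger0_norm// -sqrtr_sqr -sqrtrM; last first.
  (* The sign of [C'] is read off the two cost bounds at level 0. *)
  rewrite mulr_ge0 ?(ltW C0)//; have [+ +] := Cle 0.
  rewrite mulr0 expR0 !mulr1 => h1 h2.
  exact/ltW/(lt_trans c0)/(lt_trans h1).
rewrite ler_wsqrtr//.
have -> : (rho ^+ l) ^+ 2 = expR (- beta * l%:R) * expR (gamma * l%:R).
  rewrite -exprM /rho -expRM_natl -expRD natrM; congr expR; by field.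
rewrite mulrACA ler_pM//; first exact: Vl_ge0.
  exact/ltW/Cst_gt0.
by case: (Cle l) => _ /ltW.
Qed.

Lemma q0_gt0 : 0 < q 0.
Proof. by rewrite sqrtr_gt0 mulr_gt0// Cst_gt0. Qed.

(** Here [x l] is the factor that sets the sample size and [q l] the summand of [Sk]; dividing V_l
    by M_l cancels [x l] and leaves the summable [q l]. *)
Lemma mul_xq l : x l * q l = v l.
Proof.
have Cl := Cst_gt0 l; have vl := Vl_ge0 l.
rewrite /x /q -sqrtrM; last by rewrite divr_ge0// ltW.
have -> : v l / Cst l * (v l * Cst l) = v l ^+ 2 by field; rewrite gt_eqF.
by rewrite sqrtr_sqr ger0_norm.
Qed.

Lemma q0_le_S eps : q 0 <= S eps.
Proof. by rewrite /S /Sk big_ord_recl lerDl sumr_ge0. Qed.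

Definition Smax := Num.sqrt (C * C') / (1 - rho).

Lemma S_le_Smax eps : S eps <= Smax.
Proof.
rewrite /S /Sk (@le_trans _ _ (\sum_(l < (L eps).+1) Num.sqrt (C * C') * rho ^+ l))//.
  by apply: ler_sum => l _; exact: q_le.
rewrite -mulr_sumr ler_wpM2l// geometric_sum_le ?rho_lt1//.
exact/ltW/rho_gt0.
Qed.

Lemma M_ge eps l : 0 < eps -> x l * q 0 <= eps ^+ 2 * (M eps l)%:R.
Proof.
move=> e0; have e2 : 0 < eps ^+ 2 by rewrite exprn_gt0.
rewrite mulrC -ler_pdivrMl//.
apply: le_trans (ceil_max1_ge _); rewrite -/(S eps) -/(x l) -mulrA.
by rewrite ler_wpM2l ?invr_ge0 ?(ltW e2)// [leRHS]mulrC ler_wpM2r ?sqrtr_ge0// q0_le_S.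
Qed.

(** Rounding up costs at most one sample, hence at most 1 after multiplication by [eps ^+ 2]. *)
Lemma M_le eps l : 0 < eps -> eps <= 1 ->
  eps ^+ 2 * (M eps l)%:R <= x l * Smax + 1.
Proof.
move=> e0 e1; have e2 : 0 < eps ^+ 2 by rewrite exprn_gt0.
have e21 : eps ^+ 2 <= 1 by rewrite expr_le1// ltW.
rewrite mulrC -ler_pdivlMr// mulrC.
have S0 : 0 <= S eps by exact: le_trans (ltW q0_gt0) (q0_le_S eps).
apply: le_trans (ceil_max1_le _) _; rewrite -/(S eps) -/(x l).
  by rewrite !mulr_ge0// ?sqrtr_ge0// invr_ge0 ltW.
rewrite mulrDr mulr1 -mulrA lerD//; last by rewrite invf_ge1.
by rewrite ler_wpM2l ?invr_ge0 ?(ltW e2)// ler_wpM2l ?sqrtr_ge0// S_le_Smax.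
Qed.

Lemma Vl_div_M_le eps l : 0 < eps -> v l / (M eps l)%:R <= eps ^+ 2 * q l / q 0.
Proof.
move=> e0; have Me := M_ge l e0.
rewrite ler_pdivrMr ?M_gt0// mulrAC ler_pdivlMr ?q0_gt0//.
rewrite -mul_xq mulrAC -[leRHS]mulrAC ler_wpM2r ?sqrtr_ge0//.
Qed.

(** By [M_le], level 0 alone contributes at least [kappa * eps ^+ 2] to the variance; the assumption
    V_0 > 0 makes this positive. *)
Definition kappa := v 0 / (x 0 * Smax + 1).

Lemma Smax_ge0 : 0 <= Smax.
Proof. by rewrite divr_ge0 ?sqrtr_ge0// subr_ge0 ltW// rho_lt1. Qed.

Lemma kappa_gt0 : 0 < kappa.
Proof. by rewrite divr_gt0// ltr_wpDl// mulr_ge0 ?sqrtr_ge0 ?Smax_ge0. Qed.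

Lemma VarA_ge eps : 0 < eps -> eps <= 1 -> kappa * eps ^+ 2 <= VarA eps.
Proof.
move=> e0 e1; rewrite VarAE big_ord_recl.
apply: (@le_trans _ _ (v 0 / (M eps 0)%:R)); last first.
  rewrite lerDl sumr_ge0// => l _.
  by rewrite divr_ge0 ?Vl_ge0// ltW// M_gt0.
rewrite ler_pdivlMr ?M_gt0// -mulrA.
apply: (@le_trans _ _ (kappa * (x 0 * Smax + 1))).
  by rewrite ler_wpM2l ?(ltW kappa_gt0)// M_le.
by rewrite /kappa divfK// gt_eqF// ltr_wpDl// mulr_ge0 ?sqrtr_ge0 ?Smax_ge0.
Qed.

Lemma VarA_gt0 eps : 0 < eps -> eps <= 1 -> 0 < VarA eps.
Proof.
move=> e0 e1; apply: lt_le_trans (VarA_ge e0 e1).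
by rewrite mulr_gt0 ?kappa_gt0// exprn_gt0.
Qed.

Definition dom := Num.sqrt (C * C') / (q 0 * kappa).

Lemma dom_ge0 l : 0 <= dom * rho ^+ l.
Proof.
rewrite mulr_ge0 ?exprn_ge0 ?(ltW rho_gt0)// divr_ge0 ?sqrtr_ge0//.
by rewrite mulr_ge0 ?sqrtr_ge0// ltW ?kappa_gt0.
Qed.

(** V_l / M_l is at most eps^2 q_l / q_0 and the variance at least kappa eps^2, so [eps] cancels and
    a geometric bound independent of [eps] remains, as [tannery] requires. *)
Lemma weight_le eps l : 0 < eps -> eps <= 1 ->
  v l / ((M eps l)%:R * VarA eps) <= dom * rho ^+ l.
Proof.
move=> e0 e1; have e2 : 0 < eps ^+ 2 by rewrite exprn_gt0.
have VA := VarA_gt0 e0 e1; have k0 := kappa_gt0; have q00 := q0_gt0.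
rewrite invfM mulrA ler_pdivrMr//.
apply: (le_trans (Vl_div_M_le l e0)).
apply: (@le_trans _ _ (dom * rho ^+ l * (kappa * eps ^+ 2))); last first.
  by rewrite ler_wpM2l ?dom_ge0// VarA_ge.
have -> : dom * rho ^+ l * (kappa * eps ^+ 2) =
    eps ^+ 2 * (Num.sqrt (C * C') * rho ^+ l) / q 0.
  by rewrite /dom; field; rewrite !gt_eqF.
by rewrite ler_pM2r ?invr_gt0// ler_pM2l// q_le.
Qed.

(** On a fixed nondegenerate level M_l is at least of order eps^-2 and the standard deviation at
    least of order eps; the rate 1 / eps serves both conclusions. *)
Lemma M_lower l : 0 < v l -> exists2 K, 0 < K &
  forall eps, 0 < eps -> eps <= 1 ->
    K / eps <= (M eps l)%:R /\ K / eps <= (M eps l)%:R * Num.sqrt (VarA eps).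
Proof.
move=> vl; have k0 := kappa_gt0; have q00 := q0_gt0.
have x0 : 0 < x l by rewrite sqrtr_gt0 divr_gt0// Cst_gt0.
have xq : 0 < x l * q 0 by exact: mulr_gt0.
exists (x l * q 0 * Num.min 1 (Num.sqrt kappa)).
  by rewrite mulr_gt0// lt_min ltr01 sqrtr_gt0.
move=> eps e0 e1; have e2 : 0 < eps ^+ 2 by rewrite exprn_gt0.
have Me := M_ge l e0; have Mp := M_gt0 eps l.
have m1 : Num.min 1 (Num.sqrt kappa) <= 1 by rewrite ge_min lexx.
have mk : Num.min 1 (Num.sqrt kappa) <= Num.sqrt kappa by rewrite ge_min lexx orbT.
have m0 : 0 <= Num.min 1 (Num.sqrt kappa) by rewrite le_min ler01 sqrtr_ge0.
have Me' : x l * q 0 <= (M eps l)%:R * eps * eps.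
  by rewrite -[leRHS]mulrA -expr2 [leRHS]mulrC.
have sV : Num.sqrt kappa * eps <= Num.sqrt (VarA eps).
  rewrite -[X in _ * X](ger0_norm (ltW e0)) -sqrtr_sqr -sqrtrM ?(ltW k0)//.
  by rewrite ler_wsqrtr// VarA_ge.
split; rewrite ler_pdivrMr//.
  apply: (@le_trans _ _ (x l * q 0)); first by rewrite ler_piMr// ltW.
  by apply: (le_trans Me'); rewrite ler_piMr// mulr_ge0// ltW.
apply: (@le_trans _ _ ((M eps l)%:R * eps * eps * Num.sqrt kappa)).
  by rewrite ler_pM// ltW.
have -> : (M eps l)%:R * eps * eps * Num.sqrt kappa =
  (M eps l)%:R * (Num.sqrt kappa * eps) * eps by ring.
by rewrite ler_wpM2r ?(ltW e0)// ler_wpM2l// ltW.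
Qed.

(** The first bound is for the maximum condition; the second drives the truncation threshold of
    Lindeberg's condition to infinity. *)
Lemma M_cvgy l r : 0 < v l -> \forall eps \near (0 : R)^'+,
  r <= (M eps l)%:R /\ r <= (M eps l)%:R * Num.sqrt (VarA eps).
Proof.
move=> vl; have [K K0 HK] := M_lower vl.
have r1 : 0 < `|r| + 1 by rewrite ltr_wpDl.
near=> eps.
have e0 : 0 < eps by near: eps; exact: nbhs_right_gt.
have e1 : eps <= 1 by near: eps; exact: nbhs_right_le.
have eK : eps <= K / (`|r| + 1).
  by near: eps; apply: nbhs_right_le; rewrite divr_gt0.
have rK : r <= K / eps.
  rewrite ler_pdivlMr//; apply: (@le_trans _ _ ((`|r| + 1) * eps)).
    by rewrite ler_wpM2r ?(ltW e0)// (le_trans (ler_norm r))// lerDl.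
  by rewrite mulrC -ler_pdivlMr.
by have [h1 h2] := HK eps e0 e1; split; exact: le_trans rK _.
Unshelve. all: by end_near. Qed.

Lemma lindeberg_cvg0 delta : 0 < delta ->
  \sum_(l < (L eps).+1) tail l (delta * ((M eps l)%:R * Num.sqrt (VarA eps))) /
     ((M eps l)%:R * VarA eps) @[eps --> (0 : R)^'+] --> (0 : R).
Proof.
move=> d0; apply: (@tannery _ _ _ _ (fun eps l =>
   tail l (delta * ((M eps l)%:R * Num.sqrt (VarA eps))) /
     ((M eps l)%:R * VarA eps)) (fun eps => (L eps).+1) dom rho).
- exact/ltW/rho_gt0.
- exact: rho_lt1.
- near=> eps => l.
  have e0 : 0 < eps by near: eps; exact: nbhs_right_gt.
  have e1 : eps <= 1 by near: eps; exact: nbhs_right_le.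
  have W0 : 0 < (M eps l)%:R * VarA eps by rewrite mulr_gt0 ?M_gt0 ?VarA_gt0.
  rewrite divr_ge0 ?tail_ge0 ?(ltW W0)//= (le_trans _ (weight_le l e0 e1))//.
  by rewrite ler_pM2r ?invr_gt0// tail_le_Vl.
move=> l; apply/cvgr0Pnorm_le => e e0.
(* On a level with V_l = 0 the sample size stays 1 and [M_cvgy] does not apply, but the truncated
   variance is then 0. *)
have [vl|] := ltP 0 (v l); last first.
  move=> vl; have v0 : v l = 0 by apply/eqP; rewrite eq_le vl Vl_ge0.
  near=> eps; have t0 r : tail l r = 0.
    by apply/eqP; rewrite eq_le tail_ge0 -v0 tail_le_Vl.
  by rewrite t0 mul0r normr0 ltW.
have G0 : 0 < dom * rho ^+ l + 1 by rewrite ltr_wpDl// dom_ge0.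
(* The level for the truncated variance: by [weight_le] the denominator M_l Var A is at least v_l /
   (dom rho^l + 1), so the quotient is then at most [e]. *)
have e'0 : 0 < e * v l / (dom * rho ^+ l + 1) by rewrite divr_gt0// mulr_gt0.
have [r0 Hr0] := tail_small l e'0.
near=> eps.
have h0 : 0 < eps by near: eps; exact: nbhs_right_gt.
have h1 : eps <= 1 by near: eps; exact: nbhs_right_le.
have W0 : 0 < (M eps l)%:R * VarA eps by rewrite mulr_gt0 ?M_gt0 ?VarA_gt0.
have Mr : r0 / delta <= (M eps l)%:R /\
    r0 / delta <= (M eps l)%:R * Num.sqrt (VarA eps).
  by near: eps; exact: M_cvgy.
rewrite ger0_norm; last by rewrite divr_ge0 ?tail_ge0// ltW.
rewrite ler_pdivrMr//.
apply: (@le_trans _ _ (e * v l / (dom * rho ^+ l + 1))).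
  by apply: Hr0; rewrite mulrC -ler_pdivrMr//; case: Mr.
rewrite -mulrA ler_pM2l// ler_pdivrMr// mulrC -ler_pdivrMr//.
by apply: (le_trans (weight_le l h0 h1)); rewrite lerDl.
Unshelve. all: by end_near. Qed.

(** Each term is the share of a level divided by M_l. As M_l >= 1, the bound on the shares still
    dominates, and on a fixed level with V_l > 0 the growth of M_l sends the term to 0; so even the
    sum over the levels vanishes. *)
Lemma max_weight_cvg0 :
  (fun eps => \big[Num.max/0]_(l < (L eps).+1)
       (v l / ((M eps l)%:R ^+ 2 * VarA eps))) @ (0 : R)^'+ --> (0 : R).
Proof.
pose b eps l := v l / ((M eps l)%:R ^+ 2 * VarA eps).
have bE eps l : b eps l = v l / ((M eps l)%:R * VarA eps) / (M eps l)%:R.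
  by rewrite /b expr2 -mulrA [(M eps l)%:R * _]mulrC invfM mulrA.
have M1 eps l : 1 <= (M eps l)%:R :> R by rewrite ler1n ceil_max1_gt0.
have W0 eps l : 0 < eps -> eps <= 1 -> 0 <= v l / ((M eps l)%:R * VarA eps).
  move=> h0 h1; rewrite divr_ge0 ?Vl_ge0// mulr_ge0// ltW// VarA_gt0//.
have : \sum_(l < (L eps).+1) b eps l @[eps --> (0 : R)^'+] --> (0 : R).
  apply: (@tannery _ _ _ _ b (fun eps => (L eps).+1) dom rho).
  - exact/ltW/rho_gt0.
  - exact: rho_lt1.
  - near=> eps => l.
    have e0 : 0 < eps by near: eps; exact: nbhs_right_gt.
    have e1 : eps <= 1 by near: eps; exact: nbhs_right_le.
    rewrite bE divr_ge0 ?W0//= (le_trans _ (weight_le l e0 e1))//.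
    by rewrite ler_pdivrMr ?M_gt0// ler_peMr// W0.
  move=> l; apply/cvgr0Pnorm_le => e e0.
  have [vl|] := ltP 0 (v l); last first.
    move=> vl; have v0 : v l = 0 by apply/eqP; rewrite eq_le vl Vl_ge0.
    by near=> eps; rewrite /b v0 mul0r normr0 ltW.
  near=> eps.
  have h0 : 0 < eps by near: eps; exact: nbhs_right_gt.
  have h1 : eps <= 1 by near: eps; exact: nbhs_right_le.
  have Mr : dom * rho ^+ l / e <= (M eps l)%:R /\
      dom * rho ^+ l / e <= (M eps l)%:R * Num.sqrt (VarA eps).
    by near: eps; exact: M_cvgy.
  rewrite bE ger0_norm; last by rewrite divr_ge0 ?W0.
  rewrite ler_pdivrMr ?M_gt0//; apply: (le_trans (weight_le l h0 h1)).
  by rewrite [leRHS]mulrC -ler_pdivrMr//; case: Mr.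
move=> sb; apply: (@squeeze_cvgr _ _ _ _ (cst 0)
    (fun eps => \sum_(l < (L eps).+1) b eps l)) => //; last exact: cvg_cst.
near=> eps; apply: bigmax_le_sum => l.
have h0 : 0 < eps by near: eps; exact: nbhs_right_gt.
have h1 : eps <= 1 by near: eps; exact: nbhs_right_le.
by rewrite bE divr_ge0 ?W0.
Unshelve. all: by end_near. Qed.

Lemma AML_clt : cvg_in_distribution P (0 : R)^'+
    (fun eps w => (A eps w - fine 'E_P[Xf (L eps)]) / Num.sqrt (VarA eps))
    (@normal_prob R 0 1).
Proof.
move=> t _; rewrite normal_prob_itvE.
pose xi eps (k : nat * nat) w :=
  (Y k.1 k.2 w - m k.1) / ((M eps k.1)%:R * Num.sqrt (VarA eps)).
have mxi eps k : measurable_fun setT (xi eps k).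
  exact: (measurableT_comp
    (measurable_scaled (fun l => (M eps l)%:R * Num.sqrt (VarA eps)) k)).
have xiE eps w : \sum_(k <- samples eps) xi eps k w =
    (A eps w - fine 'E_P[Xf (L eps)]) / Num.sqrt (VarA eps).
  exact: AML_centered.
have -> : (fun eps => P [set w | (A eps w - fine 'E_P[Xf (L eps)]) /
      Num.sqrt (VarA eps) <= t]) =
    EFin \o (fun eps => fine (P [set w | \sum_(k <- samples eps) xi eps k w <= t])).
  apply/funext => eps; under eq_set do rewrite -xiE.
  rewrite /= fineK// fin_num_measure//.
  rewrite -[X in measurable X]setTI.
  have -> : [set w | \sum_(k <- samples eps) xi eps k w <= t] =
    (fun w => \sum_(k <- samples eps) xi eps k w) @^-1` `]-oo, t] by rewrite set_itvE.
  by apply: measurable_sum.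
apply: cvg_EFin; first by near=> eps.
apply: lindeberg_clt => [|delta d0].
  near=> eps; apply: AML_normalized_sum; apply: VarA_gt0.
    by near: eps; exact: nbhs_right_gt.
  by near: eps; exact: nbhs_right_le.
apply: cvg_trans (lindeberg_cvg0 d0); apply: near_eq_cvg; near=> eps.
rewrite AML_lindeberg//; apply: VarA_gt0.
  by near: eps; exact: nbhs_right_gt.
by near: eps; exact: nbhs_right_le.
Unshelve. all: by end_near. Qed.

End mlmc_clt.

Unset Implicit Arguments. Set Strict Implicit. Set Printing Implicit Defensive.

Theorem theorem2 (d : measure_display) (T : measurableType d) (R : realType)
  (P : probability T R)
  (X : {RV P >-> R}) (Xs : nat -> {RV P >-> R}) (Cst : nat -> R)
  (Y : nat -> nat -> {RV P >-> R})
  (alpha beta gamma calpha C c C' : R) :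
  (* X, X_l in L^2 *)
  (X : T -> R) \in Lfun P 2%:E ->
  (forall l, (Xs l : T -> R) \in Lfun P 2%:E) ->
  (* Assumption A *)
  0 < alpha -> 0 < beta -> 0 < gamma -> Num.min beta gamma <= 2 * alpha ->
  0 < calpha -> 0 < C -> 0 < c -> c < C' ->
  (forall l : nat, `| fine 'E_P[(X : T -> R) \- Xs l] | <= calpha * expR (- alpha * l%:R)) ->
  (forall l : nat, Vl P (fun k => Xs k : T -> R) l <= C * expR (- beta * l%:R)) ->
  (forall l : nat, c * expR (gamma * l%:R) < Cst l /\ Cst l < C' * expR (gamma * l%:R)) ->
  (* i.i.d. samples: mutually independent, Y l i has the law of Delta_l X *)
  mutually_independent (P := P) (fun li : nat * nat => Y li.1 li.2) ->
  (forall l i, same_law P (Y l i) (DeltaX (fun k => Xs k : T -> R) l)) ->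
  (* extra hypotheses of the theorem *)
  gamma < beta ->
  0 < Vl P (fun k => Xs k : T -> R) 0 ->
  let Xf := fun k => (Xs k : T -> R) in
  let A := AML P Xf Cst alpha calpha (fun l i => Y l i : T -> R) in
  let L := Leps alpha calpha in
  let M := Mleps P Xf Cst alpha calpha in
  let VarA := fun eps => fine 'V_P[A eps] in
  (* extended CLT condition *)
  cvg_in_distribution P (0 : R)^'+
    (fun eps w => (A eps w - fine 'E_P[Xf (L eps)]) / Num.sqrt (VarA eps))
    (@normal_prob R 0 1)
  /\
  (fun eps => \big[Num.max/0]_(l < (L eps).+1)
       (Vl P Xf l / ((M eps l)%:R ^+ 2 * VarA eps))) @ (0 : R)^'+ --> (0 : R).
Proof.
move=> _ X2 _ _ _ _ _ C0 c0 _ _ Vle Cle indY lawY gb V0 Xf A L M VarA.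
split.
  exact: (AML_clt alpha calpha X2 C0 c0 Vle Cle indY lawY gb V0).
exact: (max_weight_cvg0 alpha calpha X2 C0 c0 Vle Cle indY lawY gb V0).
Qed.
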